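(* Let $\mathbf{H}$ be a variety of finite groups that is closed under extension and contains $\mathbb{Z}/p\mathbb{Z}$ for infinitely many primes $p$. Let $\overline{\mathbf{H}}$ be the variety of finite monoids all of whose subgroups belong to $\mathbf{H}$. Let $X$ be a finite set with $|X|\geq 2$, and let $\widehat{F}_{\overline{\mathbf{H}}}(X)$ be the free pro-$\overline{\mathbf{H}}$ monoid generated by $X$ (that is, a finitely generated but not procyclic free pro-$\overline{\mathbf{H}}$ monoid). Then the maximal subgroup of the minimal ideal of $\widehat{F}_{\overline{\mathbf{H}}}(X)$ is a free pro-$\mathbf{H}$ group of countable rank.
   Context: A variety of finite groups is a class of finite groups closed under (finite) direct products, subgroups and quotient groups; it is closed under extension if a finite group $G$ with a normal subgroup $N$ belongs to it whenever $N$ and $G/N$ do. A variety of finite monoids is defined analogously (closed under finite direct products, submonoids and homomorphic images). The subgroups of a monoid are its subsemigroups that are groups (their identity need not be the identity of the monoid). For a variety $\mathbf{V}$ of finite monoids, a pro-$\mathbf{V}$ monoid is a projective limit of members of $\mathbf{V}$, and $\widehat{F}_{\mathbf{V}}(X)$ denotes the free pro-$\mathbf{V}$ monoid generated by $X$: every map from $X$ to a pro-$\mathbf{V}$ monoid extends uniquely to a continuous monoid homomorphism from $\widehat{F}_{\mathbf{V}}(X)$. Every profinite monoid $M$ has a unique minimal (two-sided) ideal $I$; it is closed and contains an idempotent. For an idempotent $e\in I$, the maximal subgroup of $I$ at $e$ is the group of units $G_e$ of $eMe$; it equals $eIe$, is a closed subgroup (hence a profinite group), and is independent of the choice of $e$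 up to isomorphism of profinite groups. A subset $Y$ of a profinite group $G$ converges to the identity if each neighbourhood of the identity contains all but finitely many elements of $Y$. A pro-$\mathbf{H}$ group $F$ is free pro-$\mathbf{H}$ on a subset $Y\subseteq F$ converging to the identity if every map $\tau:Y\to H$ with $H$ a pro-$\mathbf{H}$ group and $\tau(Y)$ converging to the identity extends uniquely to a continuous homomorphism $F\to H$. Free pro-$\mathbf{H}$ of countable rank means free pro-$\mathbf{H}$ on a countably infinite subset converging to the identity. *)

(* Defs.v *)
From HB Require Import structures.
From mathcomp Require Import all_boot all_order all_algebra all_fingroup.
From mathcomp Require Import all_classical topology function_spaces.

Set Implicit Arguments.
Unset Strict Implicit.
Unset Printing Implicit Defensive.

Local Open Scope classical_set_scope.
Local Open Scope group_scope.

Record group_variety (H : finGroupType -> Prop) : Prop := GroupVariety {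
  group_variety_isog : forall G K : finGroupType,
    [set: G]%G \isog [set: K]%G -> H G -> H K;
  (* the empty family puts the trivial group in H *)
  group_variety_prod : forall (I : finType) (G : I -> finGroupType),
    (forall i, H (G i)) -> H {dffun forall i, G i};
  group_variety_sub : forall (G : finGroupType) (K : {group G}),
    H G -> H [subg K]%type;
  group_variety_quo : forall (G : finGroupType) (N : {group G}),
    N <| [set: G]%G -> H G -> H (coset_of N)
}.

Definition closed_under_extension (H : finGroupType -> Prop) : Prop :=
  forall (G : finGroupType) (N : {group G}),
    N <| [set: G]%G -> H [subg N]%type -> H (coset_of N) -> H G.

(* The finite monoids all of whose subgroups belong to H.  The embedding f need
   not send 1 to 1, so the identity of a subgroup may be any idempotent.
   Finiteness is stated as a proposition because no structure joining
   monoidType and finType can be added below finStarMonoidType. *)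
Definition monoids_with_subgroups_in (H : finGroupType -> Prop)
    (M : monoidType) : Prop :=
  finite_set [set: M] /\
  forall (G : finGroupType) (f : G -> M),
    injective f -> {morph f : x y / x * y} -> H G.

(* No compatibility between the two structures is required here: continuity of
   the operations is part of being a projective limit. *)
#[short(type="tmonoidType")]
HB.structure Definition TMonoid := {M of monoid.Monoid M & Topological M}.

#[short(type="tgroupType")]
HB.structure Definition TGroup := {G of monoid.Group G & Topological G}.

Definition directed (I : Type) (le : I -> I -> Prop) : Prop :=
  [/\ inhabited I, forall i, le i i,
      forall i j k, le i j -> le j k -> le i k
    & forall i j, exists k, le i k /\ le j k].

Section ProjectiveLimit.
Variables (I : Type) (le : I -> I -> Prop) (M_ : I -> monoidType).

(* f i j : M_ j -> M_ i is meaningful only when le i j. *)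
Variable f : forall i j : I, M_ j -> M_ i.

Definition inverse_system : Prop :=
  [/\ directed le,
      forall i j, le i j -> monoid_morphism (@f i j),
      forall i (x : M_ i), f i x = x
    & forall i j k (x : M_ k), le i j -> le j k -> f i (f j x) = f i x].

Definition discrete_prod : topologicalType :=
  prod_topology (fun i => discrete_topology (M_ i)).

Definition threads : set discrete_prod :=
  [set x | forall i j, le i j -> f i (x j : M_ j) = x i].

(* phi is an isomorphism of topological monoids from M onto the projective
   limit, seen as a submonoid and subspace of the product of the M_ i. *)
Definition is_projective_limit (M : tmonoidType) (phi : M -> discrete_prod) :
    Prop :=
  [/\ inverse_system,
      forall i, monoid_morphism (fun x => phi x i : M_ i),
      injective phi, range phi = threads
    & forall U : set M, open U <-> wopen phi U].

End ProjectiveLimit.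

Definition pro_monoid (V : monoidType -> Prop) (M : tmonoidType) : Prop :=
  exists (I : Type) (le : I -> I -> Prop) (M_ : I -> monoidType)
         (f : forall i j, M_ j -> M_ i) (phi : M -> discrete_prod M_),
    (forall i, V (M_ i)) /\ is_projective_limit le f phi.

Definition pro_group (H : finGroupType -> Prop) (G : tgroupType) : Prop :=
  exists (I : Type) (le : I -> I -> Prop) (G_ : I -> finGroupType)
         (f : forall i j, G_ j -> G_ i) (phi : G -> discrete_prod G_),
    (forall i, H (G_ i)) /\ is_projective_limit le f phi.

Definition free_pro_monoid (V : monoidType -> Prop) (X : Type)
    (F : tmonoidType) (iota : X -> F) : Prop :=
  pro_monoid V F /\
  forall (M : tmonoidType) (tau : X -> M), pro_monoid V M ->
    exists! phi : F -> M,
      [/\ monoid_morphism phi, continuous phi & forall x, phi (iota x) = tau x].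

(* The family (tau y)_(y in Y) converges to 1; the set Y itself does so when
   tau is the identity.  Convergence is that of the family, i.e. values are
   counted with multiplicity: the set of values of a constant family is finite
   and would always converge to 1. *)
Definition converges_to_one (T : Type) (Y : set T) (G : tgroupType)
    (tau : T -> G) : Prop :=
  forall U : set G, nbhs (1 : G) U -> finite_set (Y `&` [set y | ~ U (tau y)]).

(* Only the restriction of tau to Y matters. *)
Definition free_pro_group_on (H : finGroupType -> Prop) (F : tgroupType)
    (Y : set F) : Prop :=
  [/\ pro_group H F, converges_to_one Y id
    & forall (K : tgroupType) (tau : F -> K), pro_group H K ->
        converges_to_one Y tau ->
        exists! phi : F -> K,
          [/\ monoid_morphism phi, continuous phi
            & forall y, Y y -> phi y = tau y]].

Definition free_pro_group_of_countable_rank (H : finGroupType -> Prop)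
    (F : tgroupType) : Prop :=
  exists Y : set F, (Y #= [set: nat])%card /\ free_pro_group_on H Y.

Definition two_sided_ideal (M : monoidType) (I : set M) : Prop :=
  I !=set0 /\ forall a x b, I x -> I (a * x * b).

Definition minimal_ideal (M : monoidType) (I : set M) : Prop :=
  two_sided_ideal I /\
  forall J : set M, two_sided_ideal J -> J `<=` I -> J = I.

Definition local_monoid (M : monoidType) (e : M) : set M :=
  range (fun x => e * x * e).

Definition local_units (M : monoidType) (e : M) : set M :=
  [set x | local_monoid e x /\
           exists2 y, local_monoid e y & x * y = e /\ y * x = e].

Definition maximal_subgroup (M : tmonoidType) (e : M) (ee : e * e = e) : Type :=
  set_type (local_units e).

Section MaximalSubgroup.
Variables (M : tmonoidType) (e : M) (ee : e * e = e).
Local Notation G := (maximal_subgroup ee).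

HB.instance Definition _ := Topological.copy G (set_type (local_units e)).

Lemma local_mul1l x : local_monoid e x -> e * x = x.
Proof. by case=> y _ <-; rewrite !mulgA ee. Qed.

Lemma local_mul1r x : local_monoid e x -> x * e = x.
Proof. by case=> y _ <-; rewrite -!mulgA ee. Qed.

Lemma local_monoidM x y : local_monoid e x -> local_monoid e y ->
  local_monoid e (x * y).
Proof.
move=> ex ey; exists (x * y) => //.
by rewrite mulgA local_mul1l// -mulgA local_mul1r.
Qed.

Lemma local_monoid1 : local_monoid e e.
Proof. by exists e => //; rewrite !ee. Qed.

Lemma local_units1 : local_units e e.
Proof. by have l1 := local_monoid1; split=> //; exists e. Qed.

Lemma local_unitsM x y : local_units e x -> local_units e y ->
  local_units e (x * y).
Proof.
move=> [ex [x' ex' [xx' x'x]]] [ey [y' ey' [yy' y'y]]].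
split; first exact: local_monoidM.
exists (y' * x'); first exact: local_monoidM.
split.
  by rewrite -mulgA (mulgA y) yy' local_mul1l.
by rewrite -mulgA (mulgA x') x'x local_mul1l.
Qed.

Lemma max_subg_inverse (u : G) :
  {v : G | val u * val v = e & val v * val u = e}.
Proof.
apply: cid2; case: u => x /= xP; have [ex [y ey [xy yx]]] := set_mem xP.
by exists (exist _ y (mem_set (conj ey (ex_intro2 _ _ x ex (conj yx xy))))).
Qed.

Definition max_subg_one : G := exist _ e (mem_set local_units1).
Definition max_subg_mul (u v : G) : G :=
  exist _ (val u * val v)
    (mem_set (local_unitsM (set_mem (valP u)) (set_mem (valP v)))).
Definition max_subg_inv (u : G) : G := s2val (max_subg_inverse u).

Lemma max_subg_mulA : associative max_subg_mul.
Proof. by move=> u v w; apply: val_inj; rewrite /= mulgA. Qed.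

Lemma max_subg_mul1 : left_id max_subg_one max_subg_mul.
Proof. by move=> u; apply/val_inj/local_mul1l; case: (set_mem (valP u)). Qed.

Lemma max_subg_mulr1 : right_id max_subg_one max_subg_mul.
Proof. by move=> u; apply/val_inj/local_mul1r; case: (set_mem (valP u)). Qed.

Lemma max_subg_mulV : left_inverse max_subg_one max_subg_inv max_subg_mul.
Proof.
by move=> u; apply: val_inj; rewrite /= /max_subg_inv; case: max_subg_inverse.
Qed.

Lemma max_subg_mulrV : right_inverse max_subg_one max_subg_inv max_subg_mul.
Proof.
by move=> u; apply: val_inj; rewrite /= /max_subg_inv; case: max_subg_inverse.
Qed.

HB.instance Definition _ :=
  isGroup.Build G max_subg_mulA max_subg_mul1 max_subg_mulr1
    max_subg_mulV max_subg_mulrV.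

End MaximalSubgroup.

(* Main.v *)
Require Import Defs.
From HB Require Import structures.
From mathcomp Require Import all_boot all_order all_algebra all_fingroup.
From mathcomp Require Import zify.
From mathcomp Require Import finmap all_classical topology function_spaces.

Local Open Scope classical_set_scope.
Local Open Scope group_scope.

Set Implicit Arguments.
Unset Strict Implicit.
Unset Printing Implicit Defensive.

(** Let G be the maximal subgroup at e of the minimal ideal of the free
    monoid F.  Because F is residually finite, [e w e] is a unit of [e F e] for
    every w ([local_units_sandwich]); so G is the image of F under the
    retraction [w |-> e w e], and it has only countably many finite continuous
    quotients, F being finitely generated ([quotient_maps_countable]).

    Two facts then combine.

    First, Iwasawa's criterion ([free_pro_group_criterion]): a pro-H group with
    a countable base of neighbourhoods of 1 is free of countable rank as soon
    as every continuous epimorphism [phi : G -> A] lifts, through every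
    epimorphism [beta : B -> A] with B in H, to a continuous epimorphism
    [psi : G -> B].  A basis is built by successive approximation along a chain
    of finite quotients of G, each carrying a generating family with finite
    support; every prescription of values on the basis is met at some stage by
    solving one embedding problem.

    Second, these embedding problems are solvable in G
    ([embedding_solvable]).  The map phi factors through a finite image
    [pi0 : F -> S], and [alpha (pi0 w) = phi (e w e)] is a well defined function
    on the image of F.  A letter x read in state s multiplies the value of alpha
    by [(alpha s)^-1 * alpha (s * pi0 x)], and this element of A does not change
    when s is multiplied on the left by an element of G.  Lifting these elements
    arbitrarily to B gives a homomorphism from F to the wreath product of B by
    S; the subgroups of that wreath product lie in H because H is closed under
    extension.  The coordinate at the state of e restricts to a homomorphism
    psi on G that lifts phi, which settles projectivity.

    To make psi onto, the lifts must reach the kernel K of beta.  Enlarge S by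
    an aperiodic counter that records the number of letters a read since the
    last other letter, up to a bound; this adds no new subgroup.  The lift used
    for the letter b is then multiplied by an element [kappa m] of K depending
    on the value m of the counter.  For words [e b a^m b e] with m in an
    arithmetic progression [N + t p] along which the power [a^m] acts
    periodically, psi takes the value [x * kappa m * y] with x and y independent
    of m; letting [kappa m] exhaust K shows that K is in the image
    ([psi_coset], [psi_surj]). *)

(** * Topology of projective limits *)

Definition locally_constant (T : topologicalType) (S : Type) (f : T -> S) :=
  forall x, nbhs x [set y | f y = f x].

Lemma discrete_prod_open (I : Type) (M_ : I -> monoidType) (i : I)
  (A : set (M_ i)) : open [set z : discrete_prod M_ | A (z i)].
Proof.
rewrite openE => z Az.
have /cvg_sup/(_ i) : nbhs z --> z by exact: cvg_id.
apply; exists [set z : discrete_prod M_ | A (z i)]; split=> //.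
by exists A => //; exact: (@discrete_open (discrete_topology (M_ i))).
Qed.

(** A basic open set of the product constrains finitely many coordinates; on
    threads, directedness reduces these to a single one.  All topological
    arguments below go through this description of neighbourhoods by finite
    quotients. *)
Lemma limit_nbhs (I : Type) (le : I -> I -> Prop) (M_ : I -> monoidType)
    (f : forall i j, M_ j -> M_ i) (M : tmonoidType)
    (phi : M -> discrete_prod M_) : is_projective_limit le f phi ->
  forall x U, nbhs x U <-> exists i, forall y, phi y i = phi x i -> U y.
Proof.
case=> [[[[i0] _ _ le_ub] _ _ _] phiM phi_inj phi_range phi_open] x U.
have thr y i j : le i j -> f i j (phi y j) = phi y i.
  move=> leij; have : threads le f (phi y) by rewrite -phi_range; exists y.
  exact.
(* the neighbourhood filter that the statement predicts *)
pose G : set_system M :=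
  [set V | exists i, forall y, phi y i = phi x i -> V y].
have GF : Filter G.
  split=> [|V W [i Vi] [j Wj]|V W VW [i Vi]]; first by exists i0.
    have [k [leik lejk]] := le_ub i j; exists k => y yx; split.
      by apply: Vi; rewrite -!(thr _ _ _ leik) yx.
    by apply: Wj; rewrite -!(thr _ _ _ lejk) yx.
  by exists i => y /Vi/VW.
split.
- rewrite nbhsE => -[V [oV Vx] VU].
  have [W oW WV] : wopen phi V by apply/phi_open.
  suff /(_ W) : phi @ G --> phi x.
    case; first by apply: open_nbhs_nbhs; split=> //; rewrite -WV in Vx.
    by move=> i Wi; exists i => y /Wi Wy; apply: VU; rewrite -WV.
  apply/cvg_sup => i A [_ [[B oB <-] Bx] BA].
  by exists i => y yx; apply: BA; rewrite /= yx.
- move=> [i Ui].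
  rewrite nbhsE; exists [set y | phi y i = phi x i]; last by move=> y; exact: Ui.
  split=> //; apply/phi_open.
  exists [set z : discrete_prod M_ | z i = phi x i] => //.
  exact: (@discrete_prod_open _ M_ i [set phi x i]).
Qed.

Lemma continuous_locally_constant (T : topologicalType)
    (D : discreteTopologicalType) (f : T -> D) :
  continuous f <-> locally_constant f.
Proof.
split=> fC x; first exact: (fC x _ (discrete_set1 (f x))).
move=> U; rewrite nbhs_principalE => /principal_filterP Ufx.
by apply: filterS (fC x) => y /= ->.
Qed.

Definition discrete_monoid (P : monoidType) : Type := P.
HB.instance Definition _ (P : monoidType) :=
  monoid.Monoid.copy (discrete_monoid P) P.
HB.instance Definition _ (P : monoidType) :=
  DiscreteTopology.copy (discrete_monoid P) (discrete_topology P).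

(** Makes every member of V a legitimate target for the universal property of
    a free pro-V monoid: it is the limit of a one-term system. *)
Lemma discrete_pro_monoid (V : monoidType -> Prop) (P : monoidType) :
  V P -> pro_monoid V (discrete_monoid P).
Proof.
move=> VP; exists unit, (fun _ _ => True), (fun _ => P), (fun _ _ => id).
exists (fun x _ => x); split=> //; split.
- by split=> //; split=> // _ _; exists tt.
- by move=> _; split.
- by move=> x y /(congr1 (@^~ tt)).
- apply/seteqP; split=> [_ [x _ <-] []|] // x _.
  by exists (x tt) => //; apply: functional_extensionality_dep => -[].
move=> U; split=> [_|_]; last exact: discrete_open.
exists [set z : discrete_prod (fun _ : unit => P) | U (z tt)] => //.
exact: (@discrete_prod_open unit (fun=> P) tt U).
Qed.

(** * Finite monoids and their subgroups *)

Lemma finite_monoid_power (P : monoidType) (y : P) : finite_set [set: P] ->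
  exists N p, (0 < p)%N /\ forall t, y ^+ (N + t * p) = y ^+ N.
Proof.
move=> Pfin.
have [i [j [ltij yij]]] : exists i j, (i < j)%N /\ y ^+ i = y ^+ j.
  apply/not_existsP => noij; apply: infinite_nat.
  have -> : [set: nat] = (fun n => y ^+ n) @^-1` [set: P] by [].
  apply: finite_preimage => // i j _ _ yij; apply/eqP/negP => /negP.
  rewrite neq_ltn => /orP[ltij|ltji]; [apply: (noij i)|apply: (noij j)].
    by exists j.
  by exists i.
exists i, (j - i)%N; rewrite subn_gt0; split=> //; elim=> [|t IHt].
  by rewrite mul0n addn0.
by rewrite mulSn addnA subnKC ?(ltnW ltij)// expgnDr -yij -expgnDr.
Qed.

(** A right invertible element a of the finite monoid [e P e] has a power equal
    to e, so its right inverse is a power of a and commutes with it.  Powers are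
    taken in P, where [a ^+ 0] is 1 and not e; the factors e below absorb the
    difference. *)
Lemma finite_local_inverse (P : monoidType) (e a b : P) :
  finite_set [set: P] -> e * a = a -> a * e = a -> e * b = b ->
  a * b = e -> b * a = e.
Proof.
move=> Pfin ea ae eb ab.
have ee : e * e = e by rewrite -{2}ab mulgA ea.
have be n : e * (b ^+ n * e) = b ^+ n * e.
  by case: n => [|n]; rewrite ?mul1g// expgS !mulgA eb.
have abn n : a ^+ n * (b ^+ n * e) = e.
  elim: n => [|n IHn]; first by rewrite !mul1g.
  by rewrite expgSr expgS -!mulgA (mulgA a) ab be.
have [N [p [p_gt0 /(_ 1%N)]]] := finite_monoid_power a Pfin.
case: p p_gt0 => // p _.
rewrite mul1n addnC expgnDr => /(congr1 (fun x => x * (b ^+ N * e))).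
rewrite -mulgA abn expgSr -mulgA ae => ap.
by rewrite -[b]eb -ap -!mulgA (mulgA a b) ab ea.
Qed.

Section ImageGroup.
Variables (G : groupType) (P : monoidType) (r : G -> P).
Hypotheses (rM : {morph r : x y / x * y}) (r_fin : finite_set (range r)).

(** The image of r as a finite group.  P is only a monoid, and the identity of
    the image is [r 1], not the identity of P: the group laws are transported
    along chosen preimages in G.  The type mentions the proofs so that its group
    structure can be inferred from it. *)
Definition image_group : Type :=
  let _ := (rM, r_fin) in fset_set (range r).
HB.instance Definition _ := Finite.copy image_group (fset_set (range r)).

Lemma image_group_mem g : r g \in fset_set (range r).
Proof. by rewrite in_fset_set// inE; exists g. Qed.

Definition to_image g : image_group := [` image_group_mem g]%fset.

Lemma to_image_surj x : exists g, to_image g = x.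
Proof.
have := fsvalP x; rewrite in_fset_set// inE => -[g _ gx].
by exists g; apply: val_inj.
Qed.

Definition image_val (x : image_group) : P := fsval x.

Lemma image_val_inj : injective image_val. Proof. exact: val_inj. Qed.

Lemma val_to_image g : image_val (to_image g) = r g. Proof. by []. Qed.

Definition image_lift (x : image_group) : G := projT1 (cid (to_image_surj x)).
Lemma image_liftK : cancel image_lift to_image.
Proof. by move=> x; rewrite /image_lift; case: cid. Qed.

Lemma to_image_eq g h : r g = r h -> to_image g = to_image h.
Proof. by move=> gh; apply: val_inj. Qed.

Lemma image_liftE g : r (image_lift (to_image g)) = r g.
Proof. by rewrite -!val_to_image image_liftK. Qed.

Definition image_mul x y := to_image (image_lift x * image_lift y).
Definition image_inv x := to_image (image_lift x)^-1.

Lemma to_imageM : {morph to_image : x y / x * y >-> image_mul x y}.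
Proof. by move=> x y; apply: to_image_eq; rewrite !rM !image_liftE. Qed.

Lemma image_mulA : associative image_mul.
Proof.
move=> x y z; rewrite -(image_liftK x) -(image_liftK y) -(image_liftK z).
by rewrite -!to_imageM mulgA.
Qed.

Lemma image_mul1 : left_id (to_image 1) image_mul.
Proof. by move=> x; rewrite -(image_liftK x) -!to_imageM mul1g. Qed.

Lemma image_mulV : left_inverse (to_image 1) image_inv image_mul.
Proof.
by move=> x; rewrite -{2}(image_liftK x) -to_imageM mulVg.
Qed.

HB.instance Definition _ :=
  Finite_isGroup.Build image_group image_mulA image_mul1 image_mulV.

Lemma to_image_morphism : monoid_morphism (to_image : G -> image_group).
Proof. by split=> //; exact: to_imageM. Qed.

Lemma image_valM : {morph image_val : x y / x * y}.
Proof.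
move=> x y; rewrite -(image_liftK x) -(image_liftK y) -to_image_morphism.2.
exact: rM.
Qed.

End ImageGroup.

Section Variety.
Variables (H : finGroupType -> Prop) (H_variety : group_variety H).

Lemma variety_embed (G K : finGroupType) (f : G -> K) :
  injective f -> {morph f : x y / x * y} -> H K -> H G.
Proof.
move=> f_inj fM HK.
pose fm := Morphism (in2W fM : {in [set: G]%G &, {morph f : x y / x * y}}).
have HI := group_variety_sub H_variety [group of (fm @* [set: G]%G)%g] HK.
refine (group_variety_isog H_variety _ HI).
apply: isog_symr; apply: isog_trans (isog_subg _).
by apply: sub_isog => //; apply/injmP; exact: in2W.
Qed.

Lemma variety_trivial (G : finGroupType) : (forall x : G, x = 1) -> H G.
Proof.
move=> G1; have HV : H {dffun forall i : void, G}.
  by apply: (group_variety_prod H_variety (G := fun=> G)) => -[].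
apply: (variety_embed (f := fun=> 1) _ _ HV).
  by move=> x y; rewrite (G1 x) (G1 y).
by move=> x y; rewrite mulg1.
Qed.

Lemma variety_monoid (G : finGroupType) :
  H G -> monoids_with_subgroups_in H G.
Proof.
move=> HG; split; first exact: finite_finset.
by move=> K f f_inj fM; exact: (variety_embed f_inj fM HG).
Qed.

Lemma variety_submonoid (P P' : monoidType) (f : P -> P') :
  injective f -> {morph f : x y / x * y} ->
  monoids_with_subgroups_in H P' -> monoids_with_subgroups_in H P.
Proof.
move=> f_inj fM [Pfin Psub]; split.
  rewrite -[setT]/(f @^-1` [set: P']); apply: finite_preimage => //.
  exact: in2W.
move=> K g g_inj gM; apply: (Psub K (f \o g)); first exact: inj_comp.
by move=> x y /=; rewrite gM fM.
Qed.

Hypothesis H_extension : closed_under_extension H.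

(** Closure under extension in the form met in practice: the kernel N of f is
    the fibre over the idempotent [f 1], G/N is a subgroup of the monoid P, and
    N embeds in K by a map h that is only multiplicative on N. *)
Lemma variety_fibration (G K : finGroupType) (P : monoidType) (f : G -> P)
    (h : G -> K) : monoids_with_subgroups_in H P -> H K ->
  {morph f : x y / x * y} ->
  (forall x y, f x = f 1 -> f y = f 1 -> h (x * y) = h x * h y) ->
  (forall x, f x = f 1 -> h x = 1 -> x = 1) -> H G.
Proof.
move=> [_ Psub] HK fM hM h_inj.
pose N := [set x : G | `[< f x = f 1 >]]%SET.
have inN x : reflect (f x = f 1) (x \in N) by rewrite inE; exact: asboolP.
have gN : group_set N.
  apply/group_setP; split=> [|x y /inN fx /inN fy]; first exact/inN.
  by apply/inN; rewrite fM fx fy -fM mulg1.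
pose NG := Group gN.
have nN : NG <| [set: G]%G.
  rewrite /normal finset.subsetT /=; apply/fintype.subsetP => x _; rewrite inE.
  apply/fintype.subsetP => _ /imsetP[y /inN fy ->]; apply/inN.
  by rewrite conjgE !fM fy -!fM mul1g mulVg.
have norm x : x \in 'N(NG)%g by rewrite (fintype.subsetP (normal_norm nN))// inE.
apply: H_extension nN _ _.
  apply: (variety_embed (f := h \o sgval) _ _ HK) => [x y /= hxy|x y /=].
    apply/val_inj/eqP; rewrite eq_mulgV1; apply/eqP.
    have fx := inN _ (subgP x); have fy := inN _ (subgP y).
    have fV : f (val y)^-1 = f 1.
      by rewrite -[in LHS](mul1g (_^-1)) fM -fy -fM mulgV.
    have fxy : f (val x * (val y)^-1) = f 1 by rewrite fM fx fV -fM mulg1.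
    apply: h_inj => //; rewrite hM// hxy -hM// mulgV.
    by apply: (mulgI (h 1)); rewrite mulg1 -hM ?mulg1.
  by apply: hM; apply/inN/subgP.
have fr x : f (repr (coset NG x)) = f x.
  rewrite val_coset//; have /rcosetP[n /inN fn ->] := mem_repr_rcoset NG x.
  by rewrite fM fn -fM mul1g.
apply: (Psub _ (fun x : coset_of NG => f (repr x))) => x y; last first.
  by rewrite -(coset_reprK x) -(coset_reprK y) -morphM ?norm// !fr fM.
rewrite -{2}(coset_reprK x) -{2}(coset_reprK y) => fxy.
apply/rcoset_kercosetP => //; rewrite mem_rcoset; apply/inN.
by rewrite fM fxy -fM mulgV.
Qed.

Lemma variety_prod (A B : finGroupType) : H A -> H B -> H (A * B)%type.
Proof.
move=> HA HB; apply: (variety_fibration (f := snd) (h := fst) _ HA) => //.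
  exact: variety_monoid.
by move=> [x y] /= -> ->.
Qed.

(** A subgroup of the product is an extension of its image in P by a subgroup of
    P'. *)
Lemma monoid_variety_prod (P P' : monoidType) :
  monoids_with_subgroups_in H P -> monoids_with_subgroups_in H P' ->
  monoids_with_subgroups_in H (P * P')%type.
Proof.
move=> HP HP'; split.
  by rewrite -setXTT; apply: finite_setX; [case: HP | case: HP'].
move=> G f f_inj fM.
have f1M : {morph (fst \o f) : x y / x * y} by move=> x y /=; rewrite fM.
pose r : G -> P' := snd \o f.
have rM : {morph r : x y / x * y} by move=> x y; rewrite /r /= fM.
have rfin : finite_set (range r) by apply: finite_image; exact: finite_finset.
have HI : H (image_group rM rfin).
  exact: HP'.2 (@image_val_inj _ _ _ rM rfin) (@image_valM _ _ _ rM rfin).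
apply: (variety_fibration (h := to_image rM rfin) HP HI f1M).
  by move=> x y _ _; rewrite to_imageM.
move=> x fx; rewrite -[1]/(to_image rM rfin 1) => /(congr1 (@image_val _ _ _ rM rfin)).
rewrite !val_to_image => rx; apply: f_inj.
by rewrite [LHS]surjective_pairing [RHS]surjective_pairing; congr pair.
Qed.

End Variety.

(** * Finite quotients of a pro-V monoid *)

(** Surjectivity is not imposed, so that such maps can be paired. *)
Definition quotient_map (V : monoidType -> Prop) (F : tmonoidType)
    (P : monoidType) (pi : F -> P) : Prop :=
  [/\ V P, monoid_morphism pi & locally_constant pi].

Section ProMonoid.
Variables (V : monoidType -> Prop) (F : tmonoidType) (F_pro : pro_monoid V F).

Lemma pro_nbhs (x : F) U : nbhs x U <->
  exists (P : monoidType) (pi : F -> P),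
    quotient_map V pi /\ forall y, pi y = pi x -> U y.
Proof.
split=> [|[P [pi [[_ _ piC] piU]]]]; last by apply: filterS (piC x).
have [I [le [M_ [f [phi [VM lim]]]]]] := F_pro.
move=> /(limit_nbhs lim)[i phiU]; exists (M_ i), (fun y => phi y i); split=> //.
split=> // [|y]; first by case: lim => _ + _ _ _; apply.
by apply/(limit_nbhs lim); exists i.
Qed.

Lemma pro_separated (x y : F) :
  (forall (P : monoidType) (pi : F -> P), quotient_map V pi -> pi x = pi y) -> x = y.
Proof.
have [I [le [M_ [f [phi [VM lim]]]]]] := F_pro.
have [_ phiM phi_inj _ _] := lim.
move=> xy; apply: phi_inj; apply: functional_extensionality_dep => i.
apply: (xy (M_ i) (fun z => phi z i)); split=> // z.
by apply/(limit_nbhs lim); exists i.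
Qed.

(** The eventual values of the sequence in the finite quotients form a thread.
    This is the only form of compactness that the construction of a basis
    uses. *)
Lemma pro_complete (g : nat -> F) :
  (forall (P : monoidType) (pi : F -> P), quotient_map V pi ->
     exists N, forall n, (N <= n)%N -> pi (g n) = pi (g N)) ->
  exists y, forall (P : monoidType) (pi : F -> P), quotient_map V pi ->
     exists N, forall n, (N <= n)%N -> pi (g n) = pi y.
Proof.
have [I [le [M_ [f [phi [VM lim]]]]]] := F_pro.
have [_ phiM phi_inj phi_range _] := lim.
have phiQ i : quotient_map V (fun z => phi z i).
  by split=> // z; apply/(limit_nbhs lim); exists i.
move=> g_cauchy; have /choice[N gN] i := g_cauchy _ _ (phiQ i).
pose z : discrete_prod M_ := fun i => phi (g (N i)) i.
have [y _ yz] : range phi z.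
  rewrite phi_range => i j leij.
  pose m := maxn (N i) (N j).
  have mi : phi (g m) i = z i by apply: gN; exact: leq_maxl.
  have mj : phi (g m) j = z j by apply: gN; exact: leq_maxr.
  rewrite -mi -mj; have : threads le f (phi (g m)) by rewrite -phi_range; exists (g m).
  exact.
exists y => P pi [_ _ piC].
have /(limit_nbhs lim)[i piy] := piC y.
by exists (N i) => n /(gN i) gni; apply: piy; rewrite yz; exact: gni.
Qed.

End ProMonoid.

Section FreeProMonoid.
Variables (V : monoidType -> Prop) (X : Type) (F : tmonoidType) (iota : X -> F).
Hypothesis F_free : free_pro_monoid V iota.

Lemma free_lift (P : monoidType) (tau : X -> P) : V P ->
  exists2 pi : F -> P, quotient_map V pi & forall x, pi (iota x) = tau x.
Proof.
move=> VP; have [_ /(_ (discrete_monoid P) tau)] := F_free.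
case/(_ (discrete_pro_monoid VP)) => pi [[piM piC pi_iota] _].
exists pi => //; split=> //.
exact: (@continuous_locally_constant F (discrete_monoid P) pi).1 piC.
Qed.

Lemma free_lift_unique (P : monoidType) (pi pi' : F -> P) :
  quotient_map V pi -> quotient_map V pi' ->
  (forall x, pi (iota x) = pi' (iota x)) -> pi = pi'.
Proof.
move=> [VP piM piC] [_ piM' piC'] pi_iota.
have [_ /(_ (discrete_monoid P) (pi \o iota))] := F_free.
case/(_ (discrete_pro_monoid VP)) => rho [_ rho_uniq].
have piK := (@continuous_locally_constant F (discrete_monoid P) pi).2 piC.
have piK' := (@continuous_locally_constant F (discrete_monoid P) pi').2 piC'.
have <- : rho = pi by apply: rho_uniq.
by apply: rho_uniq; split=> // x; rewrite -pi_iota.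
Qed.

End FreeProMonoid.

Section Submonoid.
Variables (P : monoidType) (D : set P) (D1 : D 1).
Hypothesis DM : forall x y, D x -> D y -> D (x * y).

Definition submonoid : Type := let _ := (D1, DM) in set_type D.
HB.instance Definition _ := Choice.copy submonoid (set_type D).
Definition submonoid_val (u : submonoid) : P := val (u : set_type D).
Definition in_submonoid x (Dx : D x) : submonoid :=
  exist _ x (mem_set Dx) : set_type D.
Lemma submonoid_valP u : D (submonoid_val u).
Proof. exact: (set_mem (valP (u : set_type D))). Qed.
Lemma submonoid_val_inj : injective submonoid_val.
Proof. exact: val_inj. Qed.
Definition submonoid_mul u v : submonoid :=
  in_submonoid (DM (submonoid_valP u) (submonoid_valP v)).
Lemma submonoid_mulA : associative submonoid_mul.
Proof. by move=> u v w; apply: submonoid_val_inj; exact: mulgA. Qed.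
Lemma submonoid_mul1g : left_id (in_submonoid D1) submonoid_mul.
Proof. by move=> u; apply: submonoid_val_inj; exact: mul1g. Qed.
Lemma submonoid_mulg1 : right_id (in_submonoid D1) submonoid_mul.
Proof. by move=> u; apply: submonoid_val_inj; exact: mulg1. Qed.
HB.instance Definition _ :=
  isMonoid.Build submonoid submonoid_mulA submonoid_mul1g submonoid_mulg1.
Lemma submonoid_valM : {morph submonoid_val : u v / u * v}. Proof. by []. Qed.
End Submonoid.

Section FreeProVariety.
Variables (H : finGroupType -> Prop).
Hypotheses (H_variety : group_variety H) (H_extension : closed_under_extension H).
Let V := monoids_with_subgroups_in H.
Variables (X : Type) (F : tmonoidType) (iota : X -> F).
Hypothesis F_free : free_pro_monoid V iota.

(** The elements of F are limits of words in X: a property of a finite image of F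
    that can be proved by induction on words holds throughout.  Indeed F maps to
    the submonoid D by its universal property, and by uniqueness the composite
    with the inclusion of D is pi. *)
Lemma free_ind (P : monoidType) (pi : F -> P) (D : set P) :
  quotient_map V pi -> D 1 -> (forall x y, D x -> D y -> D (x * y)) ->
  (forall x, D (pi (iota x))) -> forall w, D (pi w).
Proof.
move=> pi_quo D1 DM Diota w; have [VP piM piC] := pi_quo.
have VD : V (submonoid D1 DM).
  exact: variety_submonoid (@submonoid_val_inj _ _ D1 DM) (@submonoid_valM _ _ D1 DM) VP.
have [rho [_ rhoM rhoC] rho_iota] :=
  free_lift F_free (fun x => in_submonoid D1 DM (Diota x)) VD.
have -> : pi = @submonoid_val _ _ D1 DM \o rho.
  apply: (free_lift_unique F_free pi_quo) => [|x]; last by rewrite /= rho_iota.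
  split=> //; first by split=> [|x y] /=; rewrite ?rhoM.1 ?rhoM.2.
  by move=> x; apply: filterS (rhoC x) => y /= ->.
exact: submonoid_valP.
Qed.

Lemma quotient_pair (P P' : monoidType) (pi : F -> P) (pi' : F -> P') :
  quotient_map V pi -> quotient_map V pi' ->
  quotient_map V (fun w => (pi w, pi' w) : (P * P')%type).
Proof.
move=> [VP piM piC] [VP' piM' piC']; split.
- exact: monoid_variety_prod.
- by split=> [|x y]; rewrite ?piM.1 ?piM'.1 ?piM.2 ?piM'.2.
- by move=> x; apply: filterS2 (piC x) (piC' x) => y /= -> ->.
Qed.

End FreeProVariety.

Section Countability.
Variables (H : finGroupType -> Prop).
Hypotheses (H_variety : group_variety H) (H_extension : closed_under_extension H).
Let V := monoids_with_subgroups_in H.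
Variables (X : finType) (F : tmonoidType) (iota : X -> F).
Hypothesis F_free : free_pro_monoid V iota.

(** A finite image of F is known up to isomorphism from its multiplication table
    and the positions of 1 and of the letters; there are countably many such
    data. *)
Let code := {n : nat & ('I_n * {ffun 'I_n * 'I_n -> 'I_n} * {ffun X -> 'I_n})%type}.

Let realizes (c : code) (P : monoidType) (pi : F -> P) : Prop :=
  exists theta : P -> 'I_(tag c),
    [/\ injective theta, theta 1 = (tagged c).1.1,
        forall x y, theta (x * y) = (tagged c).1.2 (theta x, theta y)
      & forall x, theta (pi (iota x)) = (tagged c).2 x].

(** The pair of two realizations stays in the submonoid of the pairs with the
    same number, since it does so on letters. *)
Let realizes_kernel c (P P' : monoidType) (pi : F -> P) (pi' : F -> P') :
  quotient_map V pi -> quotient_map V pi' ->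
  realizes c pi -> realizes c pi' ->
  forall x y, pi x = pi y -> pi' x = pi' y.
Proof.
move=> piQ piQ' [th [th_inj th1 thM th_iota]] [th' [th'_inj th'1 th'M th'_iota]] x y.
have same w : th (pi w) = th' (pi' w).
  pose D : set (P * P')%type := [set u | th u.1 = th' u.2].
  suff: D (pi w, pi' w) by [].
  apply: (free_ind F_free (D := D)
    (quotient_pair H_variety H_extension piQ piQ')) w.
  - by rewrite /D /= th1 th'1.
  - by move=> u v; rewrite /D /= thM th'M => -> ->.
  - by move=> z; rewrite /D /= th_iota th'_iota.
by move=> /(congr1 th); rewrite !same => /th'_inj.
Qed.

Let realizable (P : monoidType) (pi : F -> P) : quotient_map V pi ->
  exists c, realizes c pi.
Proof.
move=> [[Pfin _] _ _].
have mem x : x \in fset_set [set: P] by rewrite in_fset_set// inE.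
pose S : finType := fset_set [set: P].
pose th x : 'I_#|S| := enum_rank ([` mem x]%fset : S).
pose un (i : 'I_#|S|) : P := fsval (enum_val i : S).
have thK : cancel th un by move=> x; rewrite /th /un enum_rankK.
pose c : code := existT _ #|S|
  (th 1, [ffun u => th (un u.1 * un u.2)], [ffun x => th (pi (iota x))]).
exists c, th; split=> //=.
- exact: can_inj thK.
- by move=> x y; rewrite ffunE /= !thK.
- by move=> x; rewrite ffunE.
Qed.

(** F is finitely generated, so its topology has a countable base. *)
Lemma quotient_maps_countable :
  exists (P : nat -> monoidType) (pi : forall n, F -> P n),
    (forall n, quotient_map V (pi n)) /\
    forall (P' : monoidType) (pi' : F -> P'), quotient_map V pi' ->
      exists n, forall x y, pi n x = pi n y -> pi' x = pi' y.
Proof.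
pose quo := {P : monoidType & {rho : F -> P | quotient_map V rho}}.
pose qpi (q : quo) : F -> tag q := sval (tagged q).
have qV (q : quo) : quotient_map V (qpi q) by exact: svalP (tagged q).
have q0 : quo.
  have [P Ppi] := cid ((pro_nbhs F_free.1 (1 : F) setT).1 filterT).
  by have [pi [piV _]] := cid Ppi; exists P, pi.
have /choice[q qP] (n : nat) : exists q : quo, forall c : code, choice.unpickle n = Some c ->
    (exists q', realizes c (qpi q')) -> realizes c (qpi q).
  case: (choice.unpickle n) => [c|]; last by exists q0.
  have [[q cq]|nq] := pselect (exists q', realizes c (qpi q')).
    by exists q => _ [<-].
  by exists q0 => _ [<-].
exists (fun n => tag (q n)), (fun n => qpi (q n)); split=> [n|P' pi' piV'].
  exact: qV.
have [c cpi'] := realizable piV'; exists (choice.pickle c) => x y.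
have cq : realizes c (qpi (q (choice.pickle c))).
  by apply: qP; [exact: choice.pickleK | exists (existT _ P' (exist _ pi' piV'))].
exact: realizes_kernel (qV _) piV' cq cpi' x y.
Qed.

End Countability.

(** * A criterion for freeness of countable rank *)

Lemma finite_nat_bounded (A : set nat) : finite_set A ->
  exists m, forall i, A i -> (i < m)%N.
Proof.
move=> /finite_seqP[s ->]; exists (\max_(i <- s) i).+1 => i /= si.
by rewrite ltnS; exact: leq_bigmax_seq.
Qed.

(** The topology of G is described by a sequence of finite quotients, and
    completeness is stated for sequences: this is what the approximation of a
    basis calls for, and both are inherited easily by a closed subgroup. *)
Section Iwasawa.
Variables (H : finGroupType -> Prop).
Hypotheses (H_variety : group_variety H) (H_extension : closed_under_extension H).
Variables (G : tgroupType) (Q : nat -> finGroupType) (q : forall j, G -> Q j).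
Hypothesis HQ : forall j, H (Q j).
Hypothesis qM : forall j, monoid_morphism (@q j).
Hypothesis q_surj : forall j x, exists g, @q j g = x.
Hypothesis q_nbhs : forall g (U : set G), nbhs g U <->
  exists j, forall g', q j g' = q j g -> U g'.
Hypothesis q_separated : forall g g', (forall j, q j g = q j g') -> g = g'.
Hypothesis q_complete : forall g : nat -> G,
  (forall j, exists N, forall n, (N <= n)%N -> q j (g n) = q j (g N)) ->
  exists y, forall j, exists N, forall n, (N <= n)%N -> q j (g n) = q j y.
Hypothesis embedding : forall (A B : finGroupType) (phi : G -> A) (beta : B -> A),
  H B -> monoid_morphism phi -> locally_constant phi ->
  (forall a, exists g, phi g = a) ->
  monoid_morphism beta -> (forall a, exists b, beta b = a) ->
  exists psi : G -> B, [/\ monoid_morphism psi, locally_constant psi,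
    forall b, exists g, psi g = b & forall g, beta (psi g) = phi g].

(** An approximation to a basis of G, as seen in one finite quotient. *)
Record stage := Stage {
  stage_group :> finGroupType;
  stage_map : G -> stage_group;
  stage_gen : nat -> stage_group;
  stage_variety : H stage_group;
  stage_mapM : monoid_morphism stage_map;
  stage_mapC : locally_constant stage_map;
  stage_surj : forall b, exists g, stage_map g = b;
  stage_finite : exists m, forall i, (m <= i)%N -> stage_gen i = 1;
  stage_genP : forall K : {group stage_group},
    (forall i, stage_gen i \in K) -> forall x, x \in K
}.

Definition refines (s s' : stage) : Prop :=
  exists rho : s' -> s, [/\ monoid_morphism rho,
    forall g, rho (stage_map s' g) = stage_map s g
  & forall i, rho (stage_gen s' i) = stage_gen s i].

Lemma refines_refl s : refines s s.
Proof. by exists id. Qed.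

Lemma refines_trans s s' s'' : refines s s' -> refines s' s'' -> refines s s''.
Proof.
move=> [rho [rhoM rhog rhoi]] [rho' [rhoM' rhog' rhoi']].
exists (rho \o rho'); split=> [|g|i] /=; last 2 first.
- by rewrite rhog' rhog.
- by rewrite rhoi' rhoi.
by split=> [|x y] /=; rewrite ?rhoM'.1 ?rhoM.1// rhoM'.2 rhoM.2.
Qed.

Lemma q_locally_constant j : locally_constant (@q j).
Proof. by move=> g; apply/q_nbhs; exists j. Qed.

Lemma image_group_set (A B : finGroupType) (f : A -> B) :
  monoid_morphism f -> forall K : {group A}, group_set (f @: K)%SET.
Proof.
move=> [f1 fM] K; apply/group_setP; split; first by rewrite -f1 imset_f.
by move=> _ _ /imsetP[x Kx ->] /imsetP[y Ky ->]; rewrite -fM imset_f// groupM.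
Qed.

(** Passing to the common refinement of a stage and q j.  The old generators are
    lifted arbitrarily; the new positions from m on are filled with the elements
    of the kernel, which makes the lifted family generate again. *)
Lemma separating_stage s j : exists s', refines s s' /\
  forall g g', stage_map s' g = stage_map s' g' -> q j g = q j g'.
Proof.
pose r (g : G) : s * Q j := (stage_map s g, q j g).
have rM : {morph r : x y / x * y}.
  by move=> x y; rewrite /r (stage_mapM s).2 (qM j).2.
have rfin : finite_set (range r) by exact: finite_finset.
pose B : finGroupType := image_group rM rfin.
pose phi : G -> B := to_image rM rfin.
pose rho (x : B) : s := (image_val x).1.
have phiM : monoid_morphism phi by exact: to_image_morphism.
have rhoM : monoid_morphism rho.
  split; first by rewrite -phiM.1; exact: (stage_mapM s).1.
  by move=> x y; rewrite /rho image_valM.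
have rhophi g : rho (phi g) = stage_map s g by [].
have [m gen_m] := stage_finite s.
have /choice[c cP] i := stage_surj (stage_gen s i).
pose b i : B := if (i < m)%N then phi (c i) else
  let x := nth 1 (enum B) (i - m) in if rho x == 1 then x else 1.
have rho_b i : rho (b i) = stage_gen s i.
  rewrite /b; case: ltnP => [_|/gen_m->]; first by rewrite rhophi cP.
  by case: eqP => // _; rewrite rhoM.1.
have HB : H B.
  apply: (variety_embed H_variety (@image_val_inj _ _ _ rM rfin)
    (@image_valM _ _ _ rM rfin)).
  by apply: variety_prod => //; exact: stage_variety.
have phiC : locally_constant phi.
  move=> g; apply: filterS2 (stage_mapC s g) (q_locally_constant j g) => h /= sh qh.
  by apply: to_image_eq; rewrite /r sh qh.
have b_fin : exists m, forall i, (m <= i)%N -> b i = 1.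
  exists (m + #|B|)%N => i lei; rewrite /b ltnNge (leq_trans _ lei) ?leq_addr//=.
  by rewrite nth_default ?if_same// -cardE leq_subRL ?(leq_trans _ lei) ?leq_addr.
have bP (K : {group B}) : (forall i, b i \in K) -> forall x, x \in K.
  move=> bK x.
  have /imsetP[k Kk xk] : rho x \in Group (image_group_set rhoM K).
    by apply: stage_genP => i; rewrite -rho_b; exact: imset_f.
  pose z := x * k^-1; suff : z \in K by rewrite groupMr// groupV.
  have z1 : rho z = 1 by rewrite rhoM.2 xk -rhoM.2 mulgV rhoM.1.
  have := bK (m + index z (enum B))%N.
  by rewrite /b ltnNge leq_addr/= addKn nth_index ?mem_enum// z1 eqxx.
exists (Stage HB phiM phiC (to_image_surj (r_fin := rfin)) b_fin bP).
split; first by exists rho.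
by move=> g g' /= /(congr1 (fun x : B => (image_val x).2)).
Qed.

(** The subgroup of [s * K] generated by the pairs of prescribed components maps
    onto s; solving the embedding problem for it yields a stage on which the
    generators are sent to t by the second projection. *)
Lemma evaluating_stage s (K : finGroupType) (t : nat -> K) : H K ->
  (exists m, forall i, (m <= i)%N -> t i = 1) ->
  exists s', refines s s' /\ exists2 theta : s' -> K, monoid_morphism theta &
    forall i, theta (stage_gen s' i) = t i.
Proof.
move=> HK [m' t_m']; have [m gen_m] := stage_finite s.
pose pr i : s * K := (stage_gen s i, t i).
pose GB := <<[set z | `[< exists i, z = pr i >]]%SET>>%G.
have prGB i : pr i \in GB.
  by apply: mem_gen; rewrite inE; apply/asboolP; exists i.
pose B : finGroupType := [subg GB]%type.
pose b i : B := subg GB (pr i).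
have bE i : sgval (b i) = pr i by rewrite subgK.
pose beta (x : B) : s := (sgval x).1.
have betaM : monoid_morphism beta by [].
have beta_surj a : exists x, beta x = a.
  have /imsetP[x _ ->] : a \in Group (image_group_set betaM [set: B]%G).
    apply: stage_genP => i; apply/imsetP; exists (b i) => //.
    by rewrite /beta bE.
  by exists x.
have HB : H B by apply: group_variety_sub => //; apply: variety_prod => //; exact: stage_variety.
have [psi [psiM psiC psi_surj psiE]] :=
  embedding HB (stage_mapM s) (stage_mapC s) (stage_surj (s := s)) betaM beta_surj.
have b_fin : exists m, forall i, (m <= i)%N -> b i = 1.
  exists (maxn m m') => i; rewrite geq_max => /andP[mi m'i].
  by apply: val_inj; rewrite /= bE /pr gen_m// t_m'.
have bP (L : {group B}) : (forall i, b i \in L) -> forall x, x \in L.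
  move=> bL x.
  have valM : monoid_morphism (sgval : B -> s * K) by [].
  have /fintype.subsetP/(_ (sgval x) (subgP x)) : GB \subset Group (image_group_set valM L).
    rewrite gen_subG; apply/fintype.subsetP => z; rewrite inE => /asboolP[i ->].
    by rewrite -bE; exact: imset_f.
  by move=> /imsetP[y Ly /val_inj->].
exists (Stage HB psiM psiC psi_surj b_fin bP); split.
  by exists beta; split=> // i; rewrite /beta /= bE.
by exists (fun x : B => (sgval x).2) => // i; rewrite /= bE.
Qed.

(** A target for the basis: a family of elements of some q j, trivial beyond the
    end of the sequence.  There are countably many. *)
Let task := {j : nat & seq (Q j)}.

Lemma next_stage s n : exists s', [/\ refines s s',
  forall g g', stage_map s' g = stage_map s' g' -> q n g = q n g'
  & forall t : task, choice.unpickle n = Some t ->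
    exists2 theta : s' -> Q (tag t), monoid_morphism theta &
      forall i, theta (stage_gen s' i) = nth 1 (tagged t) i].
Proof.
have [s1 [ss1 s1q]] := separating_stage s n.
case: (choice.unpickle n) => [t|]; last by exists s1; split.
have [s2 [s12 s2t]] : exists s2, refines s1 s2 /\
    exists2 theta : s2 -> Q (tag t), monoid_morphism theta &
      forall i, theta (stage_gen s2 i) = nth 1 (tagged t) i.
  apply: evaluating_stage (HQ _) _.
  by exists (size (tagged t)) => i; exact: nth_default.
exists s2; split; first exact: refines_trans s12.
  by have [rho [_ rhog _]] := s12; move=> g g' gg'; apply: s1q; rewrite -!rhog gg'.
by move=> _ [<-].
Qed.

Lemma first_stage : inhabited stage.
Proof.
pose B : finGroupType := [subg (1%G : {group Q 0})]%type.
have B1 (x : B) : x = 1 by apply/val_inj/set1gP/subgP.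
have HB : H B by exact: group_variety_sub.
have M1 : monoid_morphism (fun _ : G => 1 : B) by split=> // x y; rewrite mulg1.
constructor; apply: (@Stage B (fun=> 1) (fun=> 1) HB M1).
- by move=> g; apply: filterS filterT.
- by move=> b; exists 1; rewrite (B1 b).
- by exists 0%N.
- by move=> K _ x; rewrite (B1 x) group1.
Qed.

Lemma stages_exist : exists st : nat -> stage, forall n, [/\
  refines (st n) (st n.+1),
  forall g g', stage_map (st n.+1) g = stage_map (st n.+1) g' -> q n g = q n g'
  & forall t : task, choice.unpickle n = Some t ->
    exists2 theta : st n.+1 -> Q (tag t), monoid_morphism theta &
      forall i, theta (stage_gen (st n.+1) i) = nth 1 (tagged t) i].
Proof.
have [s0] := first_stage.
have /choice[next nextP] (u : stage * nat) := next_stage u.1 u.2.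
exists (fix st n := if n is n.+1 then next (st n, n) else s0) => n.
exact: nextP (_, n).
Qed.

Section Limit.
Variable st : nat -> stage.
Hypothesis st_refines : forall n, refines (st n) (st n.+1).
Hypothesis st_separates : forall n g g',
  stage_map (st n.+1) g = stage_map (st n.+1) g' -> q n g = q n g'.
Hypothesis st_evaluates : forall n (t : task), choice.unpickle n = Some t ->
  exists2 theta : st n.+1 -> Q (tag t), monoid_morphism theta &
    forall i, theta (stage_gen (st n.+1) i) = nth 1 (tagged t) i.
Local Notation phi n := (stage_map (st n)).

Lemma st_refines_le n m : (n <= m)%N -> refines (st n) (st m).
Proof.
move=> /subnKC <-; elim: (m - n)%N => [|k IHk].
  by rewrite addn0; exact: refines_refl.
by rewrite addnS; exact: refines_trans IHk (st_refines _).
Qed.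

(** Choosing preimages in G defines these maps for all pairs of indices, as an
    inverse system requires; for n <= m the choice does not matter. *)
Definition bonding n m (x : st m) : st n := phi n (projT1 (cid (stage_surj x))).

Lemma bondingE n m rho : (forall g, rho (phi m g) = phi n g) ->
  @bonding n m =1 rho.
Proof.
by move=> rhog x; rewrite /bonding; case: cid => g /= <-; rewrite rhog.
Qed.

Lemma bonding_map n m g : (n <= m)%N -> @bonding n m (phi m g) = phi n g.
Proof.
by move=> lenm; have [rho [_ rhog _]] := st_refines_le lenm; rewrite (bondingE rhog).
Qed.

Lemma bonding_gen n m i : (n <= m)%N ->
  @bonding n m (stage_gen (st m) i) = stage_gen (st n) i.
Proof.
by move=> lenm; have [rho [_ rhog rhoi]] := st_refines_le lenm; rewrite (bondingE rhog).
Qed.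

Lemma bonding_morphism n m : (n <= m)%N -> monoid_morphism (@bonding n m).
Proof.
move=> lenm; have [rho [rhoM rhog _]] := st_refines_le lenm.
by split=> [|x y]; rewrite !(bondingE rhog) ?rhoM.1 ?rhoM.2.
Qed.

(** Preimages in G of the terms of a thread are eventually constant in each q j,
    because stage j.+1 determines q j. *)
Lemma thread_limit (x : forall n, st n) :
  (forall n m, (n <= m)%N -> @bonding n m (x m) = x n) ->
  exists y, forall n, phi n y = x n.
Proof.
move=> x_thread.
have /choice[g gx] n := stage_surj (x n).
have gxn n m : (n <= m)%N -> phi n (g m) = x n.
  by move=> lenm; rewrite -(bonding_map (g m) lenm) gx x_thread.
have [j|y yP] := @q_complete g.
  by exists j.+1 => n lejn; apply: st_separates; rewrite !gxn.
exists y => n; have /q_nbhs[j jP] := stage_mapC (st n) y.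
have [N Ny] := yP j; rewrite -(gxn n (maxn N n)) ?leq_maxr//.
by apply/esym/jP/Ny; exact: leq_maxl.
Qed.

Lemma st_nbhs g (U : set G) : nbhs g U <->
  exists n, forall g', phi n g' = phi n g -> U g'.
Proof.
split=> [/q_nbhs[j jU]|[n nU]]; last by apply: filterS (stage_mapC (st n) g).
by exists j.+1 => g' /st_separates/jU.
Qed.

(** The chain of stages is itself a presentation of G as a limit of groups in
    H. *)
Lemma st_pro_group : pro_group H G.
Proof.
exists nat, leq, (fun n => st n : finGroupType), @bonding.
exists (fun g n => phi n g); split=> [n|]; first exact: stage_variety.
split.
- split.
  + split; [exact: (inhabits 0%N) | exact: leqnn | by move=> i j k; exact: leq_trans |].
    by move=> i j; exists (maxn i j); rewrite leq_maxl leq_maxr.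
  + exact: bonding_morphism.
  + by move=> n x; have [g <-] := stage_surj x; exact: bonding_map.
  + move=> i j k x leij lejk; have [g <-] := stage_surj x.
    by rewrite !bonding_map// (leq_trans leij).
- by move=> n; exact: stage_mapM.
- move=> g g' gg'; apply: q_separated => j; apply: st_separates.
  exact: (congr1 (fun z : discrete_prod (fun n => st n : finGroupType) => z j.+1) gg').
- apply/seteqP; split=> [_ [g _ <-] n m|x x_thread]; first exact: bonding_map.
  have [y yx] := thread_limit x_thread; exists y => //.
  exact: functional_extensionality_dep.
- move=> U; split=> [|[W oW <-]].
    rewrite openE => oU.
    pose D : set (nat * G) := [set u | forall g', phi u.1 g' = phi u.1 u.2 -> U g'].
    pose W (u : nat * G) : set (discrete_prod (fun n => st n : finGroupType)) :=
      [set z | (z : forall n, st n) u.1 = phi u.1 u.2].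
    exists (\bigcup_(u in D) W u).
      apply: bigcup_open => u _.
      exact: (@discrete_prod_open _ (fun n => st n : finGroupType) u.1 [set phi u.1 u.2]).
    apply/seteqP; split=> [g [u Du]|g Ug]; first exact: Du.
    by have /st_nbhs[n nU] := oU _ Ug; exists (n, g).
  rewrite openE => g Wg.
  suff : (fun g n => phi n g : discrete_topology (st n)) @ g -->
      ((fun n => phi n g) : discrete_prod (fun n => st n : finGroupType)).
    by apply; exact: open_nbhs_nbhs.
  apply/cvg_sup => n A [_ [[B oB <-] Bg] BA].
  by apply/st_nbhs; exists n => g' gg'; apply: BA; rewrite /= gg'.
Qed.

Variable y : nat -> G.
Hypothesis y_gen : forall n i, phi n (y i) = stage_gen (st n) i.

Lemma agree_on_gens (K : finGroupType) (chi chi' : G -> K) :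
  monoid_morphism chi -> locally_constant chi ->
  monoid_morphism chi' -> locally_constant chi' ->
  (forall i, chi (y i) = chi' (y i)) -> chi = chi'.
Proof.
move=> chiM chiC chiM' chiC' chi_y; apply: funext => g.
(* some stage n factors both maps; D is their equalizer in it *)
have /st_nbhs[n nP] : nbhs (1 : G) [set g | chi g = chi 1 /\ chi' g = chi' 1].
  by apply: filterS2 (chiC 1) (chiC' 1).
pose D := [set x : st n | `[< exists2 g, phi n g = x & chi g = chi' g >]]%SET.
have inD x : reflect (exists2 g, phi n g = x & chi g = chi' g) (x \in D).
  by rewrite inE; exact: asboolP.
have gD : group_set D.
  apply/group_setP; split=> [|a b /inD[g1 <- g1P] /inD[g2 <- g2P]]; apply/inD.
    by exists 1; rewrite ?(stage_mapM _).1 ?chiM.1 ?chiM'.1.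
  by exists (g1 * g2); rewrite ?(stage_mapM _).2// chiM.2 chiM'.2 g1P g2P.
have /inD[g' gg' chig'] : phi n g \in Group gD.
  by apply: stage_genP => i; apply/inD; exists (y i).
have [cgg' cgg''] : chi (g * g'^-1) = chi 1 /\ chi' (g * g'^-1) = chi' 1.
  by apply: nP; rewrite (stage_mapM _).2 -gg' -(stage_mapM _).2 mulgV.
rewrite -(mulgKV g' g) chiM.2 chiM'.2 cgg' cgg'' chig'.
by rewrite chiM.1 chiM'.1.
Qed.

(** Once t is lifted to some q j, it is one of the tasks handled by the
    chain. *)
Lemma extend_from_gens (K : finGroupType) (t : nat -> K) : H K ->
  (exists m, forall i, (m <= i)%N -> t i = 1) ->
  exists chi : G -> K, [/\ monoid_morphism chi, locally_constant chi
    & forall i, chi (y i) = t i].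
Proof.
move=> HK [m tm].
(* K is itself a quotient of G, hence of some Q j, where t can be lifted. *)
pose A : finGroupType := [subg (1%G : {group K})]%type.
have A1 (x : A) : x = 1 by apply/val_inj/set1gP/subgP.
have [|||||eta [etaM etaC eta_surj _]] :=
    @embedding A K (fun=> 1) (fun=> 1) HK.
- by split=> // a b; rewrite mulg1.
- by move=> g; apply: filterS filterT.
- by move=> a; exists 1; rewrite (A1 a).
- by split=> // a b; rewrite mulg1.
- by move=> a; exists 1; rewrite (A1 a).
have /q_nbhs[j jP] := etaC 1.
have /choice[g gP] i := eta_surj (t i).
have etaE g1 g2 : q j g1 = q j g2 -> eta g1 = eta g2.
  move=> q12; have : eta (g1 * g2^-1) = 1.
    by rewrite -etaM.1; apply: jP; rewrite (qM j).2 q12 -(qM j).2 mulgV.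
  by move=> g12; rewrite -[g1](mulgKV g2) etaM.2 g12 mul1g.
have /choice[lift liftP] x := q_surj (x : Q j).
pose tj : task := existT _ j (mkseq (fun i => q j (g i)) m).
have [theta thetaM thetaP] := st_evaluates (choice.pickleK tj).
set n := choice.pickle tj in theta thetaM thetaP.
pose chi := eta \o lift \o theta \o phi n.+1.
have chiE u v : q j v = theta (phi n.+1 u) -> chi u = eta v.
  by move=> uv; apply: etaE; rewrite liftP.
exists chi; split=> [|g0|i].
- split=> [|u v]; first by rewrite -etaM.1; apply: chiE; rewrite (stage_mapM _).1 thetaM.1 (qM j).1.
  rewrite [chi u]/= [chi v]/= -etaM.2; apply: chiE.
  by rewrite (qM j).2 !liftP (stage_mapM _).2 thetaM.2.
- by apply: filterS (stage_mapC (st n.+1) g0) => h /= hg; rewrite /chi /= hg.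
rewrite [RHS](_ : _ = if (i < m)%N then eta (g i) else eta 1); last first.
  by case: ltnP => [_|/tm->]; rewrite ?gP ?etaM.1.
have nthE : theta (phi n.+1 (y i)) = if (i < m)%N then q j (g i) else 1.
  rewrite y_gen thetaP /=; case: ltnP => im; first by rewrite nth_mkseq.
  by rewrite nth_default ?size_mkseq.
by case: ltnP nthE => _ nthE; apply: chiE; rewrite nthE ?(qM j).1.
Qed.

Lemma gens_injective (K : finGroupType) (k : K) : H K -> k <> 1 -> injective y.
Proof.
move=> HK k1 i i' yi; apply/eqP/negP => /negP ii'.
have [|chi [_ _ chi_y]] := extend_from_gens (t := fun n => if n == i then k else 1) HK.
  by exists i.+1 => n; case: eqP => // ->; rewrite ltnn.
have := chi_y i'; rewrite -yi chi_y eqxx eq_sym (negPf ii').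
exact: k1.
Qed.

(** A pro-H group K is the limit of finite groups in H, and a family in K that
    converges to 1 has finite support in each of them: homomorphisms to K are
    assembled from those of [extend_from_gens].  Injectivity of y turns the
    support, a set of elements of G, into a set of indices. *)
Lemma st_free_pro_group : injective y -> free_pro_group_on H (range y).
Proof.
move=> y_inj; split; first exact: st_pro_group.
- move=> U /st_nbhs[n nU]; have [m gen_m] := stage_finite (st n).
  apply: (@sub_finite_set _ _ (y @` `I_m)); last exact: finite_image.
  move=> _ [[i _ <-] /= nUy]; exists i => //=.
  rewrite ltnNge; apply/negP => lemi; apply: nUy; apply: nU.
  by rewrite y_gen gen_m// (stage_mapM _).1.
move=> K tau [I [le [K_ [f [kap [HK lim]]]]]] tau_cvg.
have [[_ fM _ _] kapM kap_inj kap_range _] := lim.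
have kapC i : locally_constant (fun k => kap k i).
  by move=> k; apply/(limit_nbhs lim); exists i.
have chi_ex i : exists chi : G -> K_ i, [/\ monoid_morphism chi,
    locally_constant chi & forall k, chi (y k) = kap (tau (y k)) i].
  apply: (extend_from_gens (t := fun k => kap (tau (y k)) i)) => //.
  have /tau_cvg/(finite_preimage (in2W y_inj))/finite_nat_bounded[m mP] :
      nbhs (1 : K) [set k | kap k i = kap 1 i] by exact: kapC.
  exists m => k lemk; rewrite -(kapM i).1; apply: contrapT => nk.
  by have := mP k; rewrite ltnNge lemk => /(_ (conj (imageT _ _) nk)).
pose chi i := projT1 (cid (chi_ex i)).
have chiP i := projT2 (cid (chi_ex i)).
have chiM i : monoid_morphism (chi i) by have [] := chiP i.
have chiC i : locally_constant (chi i) by have [] := chiP i.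
have chi_y i k : chi i (y k) = kap (tau (y k)) i.
  by have [_ _ h] := chiP i; exact: h.
have /choice[Chi ChiP] g : exists k : K, forall i, kap k i = chi i g.
  have : range kap (fun i => chi i g).
    rewrite kap_range => i j leij.
    have -> : chi i = f i j \o chi j.
      apply: agree_on_gens => // [|h|k].
      - by split=> [|u v] /=; rewrite ?(chiM j).1 ?(chiM j).2 ?(fM _ _ leij).1 ?(fM _ _ leij).2.
      - by apply: filterS (chiC j h) => u /= ->.
      - rewrite /= !chi_y; have : threads le f (kap (tau (y k))).
          by rewrite -kap_range; exists (tau (y k)).
        by move=> /(_ i j leij).
    by [].
  by move=> [k _ kE]; exists k => i; rewrite kE.
exists Chi; split; first split.
- split=> [|g h]; apply: kap_inj; apply: functional_extensionality_dep => i.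
    by rewrite ChiP (chiM i).1 (kapM i).1.
  by rewrite (kapM i).2 !ChiP (chiM i).2.
- move=> g U /(limit_nbhs lim)[i iU].
  by apply: filterS (chiC i g) => h /= hg; apply: iU; rewrite !ChiP.
- move=> _ [k _ <-]; apply: kap_inj; apply: functional_extensionality_dep => i.
  by rewrite ChiP chi_y.
move=> Psi [PsiM PsiC Psi_y]; apply: funext => g.
apply: kap_inj; apply: functional_extensionality_dep => i; rewrite ChiP.
have -> : chi i = (fun g => kap (Psi g) i); last by [].
apply: agree_on_gens => // [|h|k].
- by split=> [|u v]; rewrite ?PsiM.1 ?PsiM.2 ?(kapM i).1 ?(kapM i).2.
- exact: PsiC (kapC i (Psi h)).
- by rewrite chi_y Psi_y//; exact: imageT.
Qed.

End Limit.

(** A nontrivial group in H is what makes the basis infinite: some homomorphism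
    separates any two of its indices. *)
Lemma free_pro_group_criterion (K : finGroupType) (k : K) : H K -> k <> 1 ->
  free_pro_group_of_countable_rank H G.
Proof.
move=> HK k1; have [st stP] := stages_exist.
have st_ref n : refines (st n) (st n.+1) by case: (stP n).
have st_sep n : forall g g', stage_map (st n.+1) g = stage_map (st n.+1) g' ->
  q n g = q n g' by case: (stP n).
have st_ev n : forall t : task, choice.unpickle n = Some t ->
    exists2 theta : st n.+1 -> Q (tag t), monoid_morphism theta &
      forall i, theta (stage_gen (st n.+1) i) = nth 1 (tagged t) i.
  by case: (stP n).
have /choice[y yP] i := thread_limit st_ref st_sep
  (fun n m lenm => bonding_gen st_ref i lenm).
have y_gen n i := yP i n.
have y_inj := gens_injective st_ev y_gen HK k1.
exists (range y); split; first exact: inj_card_eq (in2W y_inj).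

exact: (st_free_pro_group st_ref st_sep st_ev y_gen y_inj).
Qed.

End Iwasawa.

(** * Wreath products and counters *)

Section Wreath.
Variables (P : monoidType) (B : finGroupType).

(** The wreath product of B by the right regular action of P: (h, p) stands for
    the transformation that sends the pair (z, r) to (z * h r, r * p). *)
Definition wreath : Type := ((P -> B) * P)%type.
HB.instance Definition _ := Choice.copy wreath ((P -> B) * P)%type.

Definition wreath_mul (u v : wreath) : wreath :=
  (fun r => u.1 r * v.1 (r * u.2), u.2 * v.2).
Definition wreath_one : wreath := (fun=> 1, 1).

Lemma wreath_mulA : associative wreath_mul.
Proof.
move=> u v w; congr (_, _); last by rewrite /= mulgA.
by apply: funext => r /=; rewrite !mulgA.
Qed.

Lemma wreath_mul1g : left_id wreath_one wreath_mul.
Proof.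
move=> [h s]; congr (_, _); last by rewrite /= mul1g.
by apply: funext => r /=; rewrite mul1g mulg1.
Qed.

Lemma wreath_mulg1 : right_id wreath_one wreath_mul.
Proof.
move=> [h s]; congr (_, _); last by rewrite /= mulg1.
by apply: funext => r /=; rewrite mulg1.
Qed.

HB.instance Definition _ :=
  isMonoid.Build wreath wreath_mulA wreath_mul1g wreath_mulg1.

Lemma wreathM1 (u v : wreath) r : (u * v).1 r = u.1 r * v.1 (r * u.2).
Proof. by []. Qed.

Lemma wreathM2 (u v : wreath) : (u * v).2 = u.2 * v.2. Proof. by []. Qed.

End Wreath.

Section WreathVariety.
Variables (H : finGroupType -> Prop).
Hypotheses (H_variety : group_variety H) (H_extension : closed_under_extension H).

(** Let u be the P-component of the identity of a subgroup.  The elements whose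
    P-component is u form the kernel of the projection to P.  They multiply
    pointwise on the states [r * u], and are determined there because they
    absorb the identity on the left; so the kernel embeds in a power of B. *)
Lemma wreath_variety (P : monoidType) (B : finGroupType) :
  monoids_with_subgroups_in H P -> H B ->
  monoids_with_subgroups_in H (wreath P B).
Proof.
move=> HP HB; have Pfin := HP.1.
have mem x : x \in fset_set [set: P] by rewrite in_fset_set// inE.
pose S : finType := fset_set [set: P].
pose to_S x : S := [` mem x]%fset.
split.
  pose c (u : wreath P B) : {ffun S -> B} * P := ([ffun t => u.1 (fsval t)], u.2).
  have c_inj : injective c.
    move=> [h p] [h' p'] [/ffunP hh' ->]; congr (_, _); apply: funext => r.
    by have := hh' (to_S r); rewrite !ffunE.
  rewrite -[setT]/(c @^-1` [set: {ffun S -> B} * P]).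
  apply: finite_preimage (in2W c_inj) _.
  by rewrite -setXTT; apply: finite_setX => //; exact: finite_finset.
move=> G f f_inj fM.
have f2M : {morph (fun x => (f x).2) : x y / x * y} by move=> x y; rewrite fM.
have HS : H {dffun forall t : S, B} by apply: (group_variety_prod H_variety (G := fun=> B)).
pose u := (f 1).2.
have uu : u * u = u by rewrite -wreathM2 -fM mulg1.
pose h x : {dffun forall t : S, B} := [ffun t => (f x).1 (fsval t * u)].
have dM (a b : {dffun forall t : S, B}) t : (a * b) t = a t * b t by exact: dffunM.
have d1 t : (1 : {dffun forall t : S, B}) t = 1.
  by apply: (mulgI ((1 : {dffun forall t : S, B}) t)); rewrite -dM !mulg1.
apply: (variety_fibration H_variety H_extension (h := h) HP HS f2M).
  move=> x y fx fy; apply/ffunP => t.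
  rewrite dM !ffunE fM wreathM1.
  by rewrite fx -mulgA -/u uu.
move=> x fx hx; apply: f_inj.
have hr y r : (f y).1 (r * u) = h y (to_S r) by rewrite ffunE.
have f1r r : (f 1).1 (r * u) = 1.
  by apply: (mulgI ((f 1).1 r)); rewrite mulg1 -[in LHS]wreathM1 -fM mulg1.
rewrite -[x]mul1g fM [LHS]surjective_pairing [RHS]surjective_pairing.
congr pair; last by rewrite wreathM2 fx -/u uu.
by apply: funext => r; rewrite wreathM1 hr hx d1 mulg1.
Qed.
End WreathVariety.

Section Counter.
Variable n : nat.

(** The transition monoid of a counter truncated at n: (false, i) adds i to the
    counter and (true, i) sets it to i. *)
Definition counter : Type := (bool * 'I_n.+1)%type.
HB.instance Definition _ := Choice.copy counter (bool * 'I_n.+1)%type.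

Definition counter_mul (c d : counter) : counter :=
  if d.1 then d else (c.1, inord (minn (c.2 + d.2) n)).
Definition counter_one : counter := (false, ord0).

Lemma counter_inord (i : nat) : (minn i n < n.+1)%N.
Proof. by rewrite ltnS geq_minr. Qed.

Lemma counter_mulA : associative counter_mul.
Proof.
move=> [rc c] [[] d] [[] f]; rewrite /counter_mul //=.
congr (_, inord _); rewrite !inordK ?counter_inord//; lia.
Qed.

Lemma counter_mul1g : left_id counter_one counter_mul.
Proof.
case=> [[] i]; rewrite /counter_mul //=; congr (_, _); apply: val_inj => /=.
by rewrite add0n inordK ?counter_inord//; apply/minn_idPl; rewrite -ltnS.
Qed.

Lemma counter_mulg1 : right_id counter_one counter_mul.
Proof.
case=> [r i]; rewrite /counter_mul //=; congr (_, _); apply: val_inj => /=.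
by rewrite addn0 inordK ?counter_inord//; apply/minn_idPl; rewrite -ltnS.
Qed.

HB.instance Definition _ :=
  isMonoid.Build counter counter_mulA counter_mul1g counter_mulg1.

Lemma counter_reset (c d : counter) : d.1 -> c * d = d.
Proof. by move=> d1; rewrite -[LHS]/(counter_mul c d) /counter_mul d1. Qed.

Lemma counter_flag (c d : counter) : (c * d).1 = c.1 || d.1.
Proof.
rewrite -[c * d]/(counter_mul c d) /counter_mul.
by case d1: d.1; rewrite ?d1 ?orbT ?orbF.
Qed.

Lemma counter_value (c d : counter) : ~~ d.1 ->
  (c * d).2 = minn (c.2 + d.2) n :> nat.
Proof.
rewrite -[c * d]/(counter_mul c d) /counter_mul; case: d.1 => //= _.
by rewrite inordK ?counter_inord.
Qed.

(** The counter is aperiodic: all its subgroups are trivial. *)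
Lemma counter_variety (H : finGroupType -> Prop) : group_variety H ->
  monoids_with_subgroups_in H counter.
Proof.
move=> H_variety; split.
  exact: (@finite_finset (bool * 'I_n.+1)%type).
move=> G f f_inj fM; apply: variety_trivial => // x; apply: f_inj.
have fx1 : f x * f 1 = f x by rewrite -fM mulg1.
case f1: (f 1).1; first by rewrite -fx1 counter_reset.
have fxV : f x * f x^-1 = f 1 by rewrite -fM mulgV.
have /norP[fx0 fV0] : ~~ ((f x).1 || (f x^-1).1) by rewrite -counter_flag fxV f1.
have fx2 : (f x).2 = minn ((f x).2 + (f 1).2) n :> nat.
  by rewrite -counter_value ?f1// fx1.
have f12 : (f 1).2 = minn ((f x).2 + (f x^-1).2) n :> nat.
  by rewrite -counter_value// fxV.
rewrite [LHS]surjective_pairing [RHS]surjective_pairing f1 (negPf fx0).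
congr (_, _); apply: val_inj => /=.
have := ltn_ord (f x).2; have := ltn_ord (f 1).2.
lia.
Qed.

End Counter.

(** * The maximal subgroup and its embedding problems *)

Section MaximalSubgroup.
Variables (H : finGroupType -> Prop).
Hypotheses (H_variety : group_variety H) (H_extension : closed_under_extension H).
Let V := monoids_with_subgroups_in H.
Variables (X : finType) (F : tmonoidType) (iota : X -> F).
Hypothesis F_free : free_pro_monoid V iota.
Variables (I : set F) (I_min : minimal_ideal I).
Variables (e : F) (Ie : I e) (ee : e * e = e).
Let G : tgroupType := maximal_subgroup ee.

Lemma minimal_ideal_divides x : I x -> exists u v, e = u * x * v.
Proof.
move=> Ix; have [[_ Imul] I_least] := I_min.
pose J := [set y | exists u v, y = u * x * v].
have JI : J = I.
  apply: I_least => [|_ [u [v ->]]]; last exact: Imul.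
  split=> [|a _ b [u [v ->]]]; first by exists x, 1, 1; rewrite mul1g mulg1.
  by exists (a * u), (v * b); rewrite !mulgA.
by have : J e by rewrite JI.
Qed.

(** Holds in every finite quotient of F, hence in F. *)
Lemma local_right_inverse a b : e * a = a -> a * e = a -> e * b = b ->
  a * b = e -> b * a = e.
Proof.
move=> ea ae eb ab; apply: (pro_separated F_free.1) => P pi [[Pfin _] piM _].
rewrite piM.2; apply: finite_local_inverse => //; by rewrite -piM.2 ?ea ?ae ?eb ?ab.
Qed.

(** With x = e w e in the minimal ideal, e = u x v for some u and v, and these can
    be replaced by a = e u e and c = e v e.  Then a (x c) = e and (a x) c = e:
    one-sided inverses being two-sided in e F e, x is invertible. *)
Lemma local_units_sandwich w : local_units e (e * w * e).
Proof.
have [[_ Imul] _] := I_min.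
have [x xE] : exists x, x = e * w * e by eexists.
have ex : e * x = x by rewrite xE !mulgA ee.
have xe : x * e = x by rewrite xE -!mulgA ee.
have Ix : I x by rewrite xE -mulgA -[e]mul1g; exact: Imul.
rewrite -xE.
have [u [v euv]] := minimal_ideal_divides Ix.
have [a aE] : exists a, a = e * u * e by eexists.
have [c cE] : exists c, c = e * v * e by eexists.
have axc : a * x * c = e.
  have -> : a * x = e * u * x by rewrite aE -mulgA ex.
  rewrite cE !mulgA -(mulgA _ x e) xe.
  have -> : e * u * x * v = e * (u * x * v) by rewrite !mulgA.
  by rewrite -euv !ee.
have ea : e * a = a by rewrite aE !mulgA ee.
have ae : a * e = a by rewrite aE -!mulgA ee.
have ec : e * c = c by rewrite cE !mulgA ee.
have ce : c * e = c by rewrite cE -!mulgA ee.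
have xca : x * c * a = e.
  by apply: local_right_inverse; rewrite ?mulgA ?ea ?ae ?ex.
have cax : c * (a * x) = e.
  by apply: local_right_inverse; rewrite ?mulgA ?ea ?ec// -mulgA xe.
split; first by exists w.
exists (c * a); last by split; [rewrite mulgA | rewrite -mulgA].
by exists (c * a) => //; rewrite mulgA ec -mulgA ae.
Qed.

Definition sandwich w : G := exist _ (e * w * e) (mem_set (local_units_sandwich w)).

Lemma val_sandwich w : val (sandwich w) = e * w * e. Proof. by []. Qed.

Lemma val_mul (g h : G) : val (g * h) = val g * val h. Proof. by []. Qed.

Lemma val_mule (g : G) : val g * e = val g.
Proof. exact: (congr1 val (mulg1 g)). Qed.

Lemma val_emul (g : G) : e * val g = val g.
Proof. exact: (congr1 val (mul1g g)). Qed.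

Lemma sandwichK (g : G) : sandwich (val g) = g.
Proof. by apply: val_inj; rewrite val_sandwich val_emul val_mule. Qed.

Lemma maximal_subgroup_nbhs (g : G) (U : set G) : nbhs g U <->
  exists (P : monoidType) (pi : F -> P), quotient_map V pi /\
    forall h : G, pi (val h) = pi (val g) -> U h.
Proof.
split=> [[_ [[W oW <-] Wg] WU]|[P [pi [piV piU]]]].
  have /(pro_nbhs F_free.1)[P [pi [piV piW]]] : nbhs (val g) W.
    by apply: open_nbhs_nbhs; split.
  by exists P, pi; split=> // h /piW Wh; exact: WU.
have : nbhs (val g) [set w | pi w = pi (val g)] by case: piV.
rewrite nbhsE => -[W [oW Wg] Wpi].
exists (val @^-1` W); split=> //; first by exists W.
by move=> h Wh; apply: piU; exact: Wpi.
Qed.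

Lemma quotient_locally_constant (P : monoidType) (pi : F -> P) :
  quotient_map V pi -> locally_constant (fun g : G => pi (val g)).
Proof. by move=> piV g; apply/maximal_subgroup_nbhs; exists P, pi. Qed.

Lemma maximal_subgroup_complete (g : nat -> G) :
  (forall (P : monoidType) (pi : F -> P), quotient_map V pi ->
     exists N, forall n, (N <= n)%N -> pi (val (g n)) = pi (val (g N))) ->
  exists y : G, forall (P : monoidType) (pi : F -> P), quotient_map V pi ->
     exists N, forall n, (N <= n)%N -> pi (val (g n)) = pi (val y).
Proof.
move=> /(pro_complete F_free.1)[y yP]; exists (sandwich y) => P pi piV.
have [N Ny] := yP P pi piV; exists N => n /Ny ny; have [_ piM _] := piV.
by rewrite val_sandwich !piM.2 -ny -!piM.2 val_emul val_mule.
Qed.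

Lemma quotient_comp (P P' : monoidType) (pi : F -> P) (f : P -> P') :
  quotient_map V pi -> monoid_morphism f -> V P' -> quotient_map V (f \o pi).
Proof.
move=> [_ piM piC] fM VP'; split=> //.
  by split=> [|x y] /=; rewrite ?piM.1 ?fM.1 ?piM.2 ?fM.2.
by move=> w; apply: filterS (piC w) => v /= ->.
Qed.

(** Here phi factors through pi0 on G, alpha extends it along pi0, and lift is a
    section of beta.  The states are pairs of an element of S and a counter. *)
Section Embedding.
Variables (A B : finGroupType) (phi : G -> A) (beta : B -> A).
Hypothesis phiM : monoid_morphism phi.
Hypothesis phi_surj : forall a, exists g, phi g = a.
Hypothesis betaM : monoid_morphism beta.
Variables (S : monoidType) (pi0 : F -> S).
Hypothesis pi0V : quotient_map V pi0.
Variable alpha : S -> A.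
Hypothesis alphaE : forall w, alpha (pi0 w) = phi (sandwich w).
Variable lift : A -> B.
Hypothesis liftK : cancel lift beta.
Variables (a b : X).
Hypothesis ab : a != b.

(** The element of A by which the letter x changes the value of alpha at s, lifted
    to B. *)
Let eta x s := lift ((alpha s)^-1 * alpha (s * pi0 (iota x))).
Let ya : wreath S B := (eta a, pi0 (iota a)).

Variables (N p : nat).
Hypothesis p_gt0 : (0 < p)%N.
Hypothesis ya_period : forall t, ya ^+ (N + t * p) = ya ^+ N.

(** The bound lets the counter reach N + t * p for every t < #|B| without
    truncation; the successor makes room for a single letter even when the sum
    vanishes. *)
Let n := (N + #|B| * p).+1.

(** Along N + t * p this runs through the elements of B, those outside the kernel
    of beta being replaced by 1. *)
Let kappa m := let z := nth 1 (enum B) ((m - N) %/ p) in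
  if beta z == 1 then z else 1.
Let P : monoidType := (S * counter n)%type.
Definition letter x : wreath P B :=
  (fun s : P => eta x s.1 * (if x == b then kappa (s.2 : counter n).2 else 1),
   (pi0 (iota x), (if x == a then (false, inord 1) else (true, ord0)) : counter n) : P).

Variable Phi : F -> wreath P B.
Hypothesis PhiV : quotient_map V Phi.
Hypothesis Phi_iota : forall x, Phi (iota x) = letter x.

Let PhiM := let: And3 _ h _ := PhiV in h.
Let pi0M := let: And3 _ h _ := pi0V in h.
Let h w := (Phi w).1.
Let pi w : P := (Phi w).2.

Lemma kappa_ker m : beta (kappa m) = 1.
Proof. by rewrite /kappa; case: eqP => // _; exact: betaM.1. Qed.

Lemma kappa_surj z : beta z = 1 -> kappa (N + index z (enum B) * p) = z.
Proof.
move=> z1; rewrite /kappa addKn mulnK// nth_index ?mem_enum//.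
by rewrite z1 eqxx.
Qed.

Lemma piM : monoid_morphism pi.
Proof. by split=> [|u v]; rewrite /pi ?PhiM.1 ?PhiM.2. Qed.

Lemma hM u v r : h (u * v) r = h u r * h v (r * pi u).
Proof. by rewrite /h PhiM.2. Qed.

Lemma h1 r : h 1 r = 1.
Proof. by rewrite /h PhiM.1. Qed.

Lemma pi_fst w : (pi w).1 = pi0 w.
Proof.
pose f (u : wreath P B) : S := u.2.1.
have fM : monoid_morphism f by [].
have VS : V S by case: pi0V.
have /= fE := free_lift_unique F_free (quotient_comp PhiV fM VS) pi0V.
have -> : (pi w).1 = (f \o Phi) w by [].
by rewrite fE// => x; rewrite /f /= Phi_iota.
Qed.

Lemma sandwich_mul (g : G) w : sandwich (val g * w) = g * sandwich w.
Proof.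
apply: val_inj; rewrite val_mul !val_sandwich !mulgA val_emul.
by rewrite val_mule.
Qed.

Lemma alpha_mul (g : G) w : alpha (pi0 (val g * w)) = phi g * alpha (pi0 w).
Proof. by rewrite !alphaE sandwich_mul phiM.2. Qed.

Lemma sandwich_e : sandwich e = 1.
Proof. by apply: val_inj; rewrite val_sandwich ee. Qed.

(** The increments of alpha telescope along a word, and the factors kappa are
    killed by beta. *)
Lemma h_beta w r : beta (h w r) = (alpha r.1)^-1 * alpha (r.1 * pi0 w).
Proof.
pose D : set (wreath P B) := [set u | forall r,
  beta (u.1 r) = (alpha r.1)^-1 * alpha (r.1 * u.2.1)].
suff : D (Phi w) by move=> /(_ r); rewrite -/(pi w) pi_fst.
apply: (free_ind F_free (D := D) PhiV) => [s|u v Du Dv s|x s].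
- by rewrite betaM.1 mulg1 mulVg.
- rewrite wreathM1 betaM.2 Du Dv [LHS]mulgA mulgK.
  by congr (_ * alpha _); rewrite [RHS]mulgA.
rewrite Phi_iota /= betaM.2 liftK; case: eqP => _; last by rewrite betaM.1 mulg1.
by rewrite kappa_ker mulg1.
Qed.

Lemma pi_b : (pi (iota b)).2 = (true, ord0).
Proof. by rewrite /pi Phi_iota /= eq_sym (negPf ab). Qed.

(** Since e factors through b, it resets the counter. *)
Lemma pi_e_flag : (pi e).2.1.
Proof.
have Ibe : I (iota b * e).
  by have [[_ Imul] _] := I_min; rewrite -[_ * e]mulg1; exact: Imul.
have [u [v ->]] := minimal_ideal_divides Ibe.
by rewrite !piM.2 !counter_flag pi_b /= !orbT.
Qed.

(** The labels of a path do not depend on the fibre of G in which it starts: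
    multiplying a state of e F on the left by g multiplies alpha by phi g, which
    cancels in the increments, and leaves the counter alone because e
    resets it. *)
Lemma h_invariant w (g : G) u : h w (pi (val g) * pi (e * u)) = h w (pi (e * u)).
Proof.
pose D : set (wreath P B) := [set v | (exists w, v = Phi w) /\ forall (g : G) u,
  v.1 (pi (val g) * pi (e * u)) = v.1 (pi (e * u))].
suff [_ Dw] : D (Phi w) by exact: Dw.
apply: (free_ind F_free (D := D) PhiV) => [|_ _ [[v ->] Dv] [[v' ->] Dv']|x].
- by split; first by exists 1; rewrite PhiM.1.
- split=> [|g' u']; first by exists (v * v'); rewrite PhiM.2.
  rewrite !wreathM1 Dv -/(pi v) -(mulgA (pi _)) -piM.2 -(mulgA e) Dv'.
  by rewrite mulgA piM.2.
split=> [|g' u']; first by exists (iota x).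
rewrite Phi_iota /= !pi_fst -!pi0M.2 /eta -!pi0M.2 -!(mulgA (val g')) !alpha_mul.
rewrite invMg [X in lift X]mulgA mulgVK.
congr (_ * (if _ then kappa _ else _)).
by rewrite counter_reset// piM.2 counter_flag pi_e_flag.
Qed.

Let psi (g : G) := h (val g) (pi e).

(** After g the state differs from that of e by g only; the invariance makes the
    cocycle h a homomorphism on G. *)
Lemma psiM : monoid_morphism psi.
Proof.
have psi_mul : {morph psi : x y / x * y}.
  move=> x y; rewrite /psi val_mul hM; congr (_ * _).
  have := h_invariant (val y) x 1.
  by rewrite mulg1 -!piM.2 val_emul val_mule.
by split=> //; apply: (mulgI (psi 1)); rewrite -psi_mul !mulg1.
Qed.

Lemma psi_beta g : beta (psi g) = phi g.
Proof.
rewrite /psi h_beta pi_fst -pi0M.2 !alphaE sandwich_e phiM.1 invg1 mul1g.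
by rewrite val_emul sandwichK.
Qed.

Lemma h_a m r : h (iota a ^+ m) r = (ya ^+ m).1 r.1.
Proof.
elim: m r => [|m IHm] r; first by rewrite h1.
rewrite !expgS hM wreathM1 IHm /h /pi Phi_iota /= (negPf ab) mulg1.
by [].
Qed.

Lemma ya2 m : (ya ^+ m).2 = pi0 (iota a ^+ m).
Proof.
elim: m => [|m IHm]; first by rewrite pi0M.1.
by rewrite !expgS wreathM2 IHm pi0M.2.
Qed.

Lemma pi_a_count m : (m <= n)%N ->
  (pi (iota a ^+ m)).2.1 = false /\ (pi (iota a ^+ m)).2.2 = m :> nat.
Proof.
elim: m => [|m IHm] lemn; first by rewrite piM.1.
have [cf cv] := IHm (ltnW lemn).
have aE : (pi (iota a)).2 = (false, inord 1) by rewrite /pi Phi_iota /= eqxx.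
rewrite expgSr piM.2 counter_flag counter_value aE/= ?cf//; split=> //.
by rewrite cv inordK// addn1; exact/minn_idPl.
Qed.

(** A word ending in b a^m leaves the counter at m, so that the letter b read next
   contributes kappa m; apart from this factor the value of psi on e b a^m b e
   depends on m only through the m-th power of ya. *)
Lemma psi_coset : exists x w, forall k, beta k = 1 ->
  exists g, psi g = x * k * w.
Proof.
pose r1 : P := pi e * pi e.
pose s2 := r1.1 * (pi0 (iota b) * (ya ^+ N).2).
pose s3 := (pi e).1 * (pi0 e * (pi0 (iota b) * (ya ^+ N).2 * pi0 (iota b))).
exists (h e (pi e) * (h (iota b) r1 * (ya ^+ N).1 (r1 * pi (iota b)).1 * eta b s2)).
exists (h e (s3, (true, ord0) : counter n)) => k k1.
pose t := index k (enum B); pose m := (N + t * p)%N.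
have lemn : (m <= n)%N.
  rewrite /m /n ltnW// ltnS leq_add2l leq_mul2r ltnW ?orbT//.
  by rewrite cardE index_mem mem_enum.
have [cf cv] := pi_a_count lemn.
have yam : ya ^+ m = ya ^+ N by exact: ya_period.
have bam2 : (pi (iota b * iota a ^+ m)).2.2 = m :> nat.
  rewrite piM.2 counter_value ?cf// pi_b /= cv add0n; exact/minn_idPl.
have bam1 : (pi (iota b * iota a ^+ m)).2.1.
  by rewrite piM.2 counter_flag pi_b.
exists (sandwich (iota b * iota a ^+ m * iota b)).
rewrite /psi val_sandwich !hM -/r1.
have -> : h (iota a ^+ m) (r1 * pi (iota b)) = (ya ^+ N).1 (r1 * pi (iota b)).1.
  by rewrite h_a yam.
have -> : h (iota b) (r1 * pi (iota b * iota a ^+ m)) = eta b s2 * k.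
  have s2E : (r1 * pi (iota b * iota a ^+ m)).1 = s2.
    by rewrite -[LHS]/(r1.1 * (pi (_ * _)).1) (pi_fst (_ * _)) pi0M.2 -ya2 yam.
  have mE : ((r1 * pi (iota b * iota a ^+ m)).2 : counter n).2 = m :> nat.
    by rewrite -[X in X.2]/(r1.2 * (pi (_ * _)).2) counter_reset.
  have letterE (s : P) : (letter b).1 s = eta b s.1 * kappa (s.2 : counter n).2.
    by rewrite /= eqxx.
  rewrite {1}/h Phi_iota letterE s2E mE.
  by congr (_ * _); exact: kappa_surj.
have -> : pi e * pi (e * (iota b * iota a ^+ m * iota b)) =
    (s3, (true, ord0) : counter n).
  rewrite [LHS]surjective_pairing; congr pair.
    by rewrite -[LHS]/((pi e).1 * (pi (_ * _)).1) (pi_fst (_ * _)) !pi0M.2 -ya2 yam.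
  have endb u : (pi (u * iota b)).2 = ((true, ord0) : counter n).
    by rewrite piM.2 -[LHS]/((pi u).2 * (pi (iota b)).2) pi_b counter_reset.
  by rewrite -[LHS]/((pi e).2 * (pi (_ * _)).2) mulgA endb counter_reset.
by rewrite !mulgA.
Qed.

(** The coset x K w of the kernel is in the image, so K = (x K w) (x w)^-1 is,
    K being normal; and the image maps onto A. *)
Lemma psi_surj z : exists g, psi g = z.
Proof.
have [x [w xw]] := psi_coset.
have psi_inv g : psi g^-1 = (psi g)^-1.
  by apply: (mulgI (psi g)); rewrite -psiM.2 !mulgV psiM.1.
have [g gz] := phi_surj (beta z).
have [k kE] : exists k, k = z * (psi g)^-1 by eexists.
have bV u : beta u^-1 = (beta u)^-1.
  by apply: (mulgI (beta u)); rewrite -betaM.2 !mulgV betaM.1.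
have k1 : beta k = 1 by rewrite kE betaM.2 bV psi_beta gz mulgV.
have [g1 g1P] : exists g, psi g = x * (x^-1 * k * x) * w.
  by apply: xw; rewrite !betaM.2 k1 mulg1 -betaM.2 mulVg betaM.1.
have [g2 g2P] := xw 1 betaM.1.
exists (g1 * g2^-1 * g); rewrite !psiM.2 psi_inv g1P g2P.
by rewrite mulg1 invMg !mulgA mulgV mul1g mulgK mulgK kE mulgVK.
Qed.

Lemma embedding_solution : exists psi : G -> B,
  [/\ monoid_morphism psi, locally_constant psi,
    forall z, exists g, psi g = z & forall g, beta (psi g) = phi g].
Proof.
exists psi; split=> [||z|g]; [exact psiM | | exact (psi_surj z) | exact (psi_beta g)].
move=> g; apply: filterS (quotient_locally_constant PhiV g) => g' /= gg'.
by rewrite /psi /h gg'.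
Qed.

End Embedding.

(** The data of the construction: pi0 from the continuity of phi at 1, two distinct
    letters a and b, and the period of a in the wreath product of B by S. *)
Lemma embedding_solvable (A B : finGroupType) (phi : G -> A) (beta : B -> A) :
  (1 < #|X|)%N -> H B -> monoid_morphism phi -> locally_constant phi ->
  (forall a, exists g, phi g = a) ->
  monoid_morphism beta -> (forall a, exists b, beta b = a) ->
  exists psi : G -> B, [/\ monoid_morphism psi, locally_constant psi,
    forall b, exists g, psi g = b & forall g, beta (psi g) = phi g].
Proof.
move=> /card_gt1P[a [b [_ _ ab]]] HB phiM phiC phi_surj betaM beta_surj.
have /maximal_subgroup_nbhs[S [pi0 [pi0V pi0_ker]]] := phiC 1.
have [VS pi0M _] := pi0V.
have pi0_phi (g h : G) : pi0 (val g) = pi0 (val h) -> phi g = phi h.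
  move=> gh; have ghV : phi (g * h^-1) = phi 1.
    by apply: pi0_ker; rewrite val_mul pi0M.2 gh -pi0M.2 -val_mul mulgV.
  by rewrite -[g](mulgVK h) phiM.2 ghV phiM.1 mul1g.
have /choice[alpha alphaP] s : exists c, forall w, pi0 w = s -> phi (sandwich w) = c.
  have [[w ws]|nw] := pselect (exists w, pi0 w = s); last first.
    by exists 1 => w ws; case: nw; exists w.
  exists (phi (sandwich w)) => w' w's; apply: pi0_phi.
  by rewrite !val_sandwich !pi0M.2 ws w's.
have /choice[lift liftK] := beta_surj.
pose eta s := lift ((alpha s)^-1 * alpha (s * pi0 (iota a))).
have VW := wreath_variety H_variety H_extension VS HB.
have [N [p [p_gt0 Np]]] := finite_monoid_power ((eta, pi0 (iota a)) : wreath S B) VW.1.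
pose n := (N + #|B| * p).+1.
have VP := monoid_variety_prod H_variety H_extension VS (counter_variety n H_variety).
have [Phi PhiV Phi_iota] := free_lift F_free (letter beta pi0 alpha lift a b N p)
  (wreath_variety H_variety H_extension VP HB).
exact: (embedding_solution phiM phi_surj betaM pi0V (alpha := alpha)
  (fun w => esym (alphaP _ w erefl)) liftK ab p_gt0 Np PhiV Phi_iota).
Qed.

Lemma maximal_subgroup_free (K : finGroupType) (k : K) :
  (1 < #|X|)%N -> H K -> k <> 1 -> free_pro_group_of_countable_rank H G.
Proof.
move=> X_gt1 HK k1.
have [P [pi [piV pi_cofinal]]] := quotient_maps_countable H_variety H_extension F_free.
pose r n (g : G) := pi n (val g).
have rM n : {morph r n : x y / x * y}.
  by move=> x y; have [_ piM _] := piV n; rewrite /r val_mul piM.2.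
have r_fin n : finite_set (range (r n)).
  by apply: (@sub_finite_set _ _ [set: P n]) => //; case: (piV n) => -[].
pose Q n : finGroupType := image_group (rM n) (r_fin n).
pose q n : G -> Q n := to_image (rM n) (r_fin n).
have qP n g g' : q n g = q n g' <-> r n g = r n g'.
  split=> [/(congr1 (@image_val _ _ _ (rM n) (r_fin n)))//|]; exact: to_image_eq.
have HQ n : H (Q n).
  have [[_ Psub] _ _] := piV n.
  exact: Psub (@image_val_inj _ _ _ (rM n) (r_fin n)) (@image_valM _ _ _ (rM n) (r_fin n)).
apply: (@free_pro_group_criterion H H_variety H_extension G Q q HQ) HK k1.
- by move=> n; exact: to_image_morphism.
- by move=> n x; exact: to_image_surj.
- move=> g U; split=> [/maximal_subgroup_nbhs[P' [pi' [/pi_cofinal[n pi_n] piU]]]|[n nU]].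
    by exists n => g' /qP/pi_n/piU.
  by apply/maximal_subgroup_nbhs; exists (P n), (pi n); split=> // g' /qP/nU.
- move=> g g' gg'; apply: val_inj.
  apply: (pro_separated F_free.1) => P' pi' /pi_cofinal[n pi_n].
  by apply: pi_n; exact/qP.
- move=> g g_cauchy.
  have [P' pi' /pi_cofinal[n pi_n]|y yP] := @maximal_subgroup_complete g.
    have [N gN] := g_cauchy n; exists N => m /gN gm.
    by apply: pi_n; exact/qP.
  exists y => n; have [N yN] := yP _ _ (piV n).
  by exists N => m /yN ym; exact/qP.
- by move=> A B phi beta; exact: embedding_solvable.
Qed.

End MaximalSubgroup.

Theorem theorem1 (H : finGroupType -> Prop)
    (H_variety : group_variety H)
    (H_extension : closed_under_extension H)
    (H_primes : infinite_set [set p : nat | prime p /\ H ('Z_p : finGroupType)])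
    (X : finType) (X_gt1 : (2 <= #|X|)%N)
    (F : tmonoidType) (iota : X -> F)
    (F_free : free_pro_monoid (monoids_with_subgroups_in H) iota)
    (I : set F) (I_minimal : minimal_ideal I)
    (e : F) (Ie : I e) (ee : e * e = e) :
  free_pro_group_of_countable_rank H (maximal_subgroup ee : tgroupType).
Proof.
have [p [p_prime Hp]] := infinite_setN0 H_primes.
pose k : 'Z_p := inZp 1.
have k_neq1 : k <> 1.
  by move=> /(congr1 val); rewrite /= modn_small.
exact: (maximal_subgroup_free H_variety H_extension F_free I_minimal Ie ee
  X_gt1 Hp k_neq1).
Qed.
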